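(* Let $k$ be a perfect field of characteristic $p>0$, let $R$ be a reduced standard graded ring over $k$ of dimension $1$, and let $I$ be a homogeneous ideal of $R$ such that $\ell(R/I)<\infty$. For $n\in\mathbb{N}$ and $q=p^n$ let $f_n(x)=\ell(R/I^{[q]})_{\lfloor xq\rfloor}$. Then $\{f_n(x)\}_{n\in\mathbb{N}}$ is a convergent sequence for every $x\in[0,\infty)$ (but $\{f_n\}_{n}$ need not be uniformly convergent, i.e. there exist such $R$ and $I$ for which the convergence is not uniform), and $$e_{HK}(I,R)=\int_{\mathbb{R}}f(x)\,dx,\qquad\text{where } f(x)=\lim_{n\to\infty}f_n(x).$$
   Context: A standard graded ring over $k$ is a Noetherian graded ring $R=\bigoplus_{m\ge0}R_m$ with $R_0=k$, generated over $k$ by $R_1$. $I^{[q]}$ is the ideal generated by $q$-th powers of elements of $I$; $(R/I^{[q]})_m$ is the degree $m$ component, which is $0$ for $m<0$ (so $f_n(x)=f(x)=0$ for $x<0$). Here $\dim R=1$ and $e_{HK}(I,R)=\lim_{n\to\infty}\ell(R/I^{[p^n]})/p^n$. *)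

(* Defs.v *)
From HB Require Import structures.
From mathcomp Require Export all_boot all_order all_algebra.
From mathcomp Require Export all_classical all_reals all_analysis.
Import Order.TTheory GRing.Theory Num.Theory.
Import numFieldNormedType.Exports.

Set Implicit Arguments.
Unset Strict Implicit.
Unset Printing Implicit Defensive.

Local Open Scope classical_set_scope.
Local Open Scope ring_scope.

Definition perfect_field (p : nat) (k : fieldType) : Prop :=
  p \in [pchar k] /\ forall x : k, exists y : k, y ^+ p = x.

(* A strictly increasing chain C 0 < ... < C n has n steps; the values of C
   beyond n are irrelevant. *)
Definition strict_chain (T : Type) (Q : set T -> Prop) (n : nat)
    (C : nat -> set T) : Prop :=
  (forall i, (i <= n)%N -> Q (C i)) /\
  (forall i, (i < n)%N -> C i `<` C i.+1).

Definition chain_height (RR : realType) (T : Type) (Q : set T -> Prop) :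
    \bar RR :=
  ereal_sup [set (n%:R)%:E | n in [set n | exists C, strict_chain Q n C]].

Definition is_submodule (A : nzRingType) (V : lmodType A) (S : set V) : Prop :=
  GRing.submod_closed (mem S).

(* Length of the A-module P / N: the submodules of P / N are the submodules of
   V lying between N and P. *)
Definition length_quot (RR : realType) (A : nzRingType) (V : lmodType A)
    (P N : set V) : \bar RR :=
  chain_height RR (fun S : set V => [/\ is_submodule S, N `<=` S & S `<=` P]).

Section Ideals.
Variable R : comNzRingType.

(* The unit ideal is allowed, unlike with idealr_closed. *)
Definition is_ideal (I : set R) : Prop := @is_submodule R R^o I.

Definition ideal_gen (A : set R) : set R := smallest is_ideal A.

Definition is_prime_ideal (P : set R) : Prop :=
  idealr_closed (mem P) /\ prime_idealr_closed (mem P).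

Definition krull_dim (RR : realType) : \bar RR := chain_height RR is_prime_ideal.

Definition noetherian_ring : Prop :=
  forall I : set R, is_ideal I -> exists s : seq R, I = ideal_gen [set` s].

Definition reduced_ring : Prop := forall (x : R) (n : nat), x ^+ n = 0 -> x = 0.

Definition frobenius_power (I : set R) (q : nat) : set R :=
  ideal_gen [set a ^+ q | a in I].

Definition ring_length_quot (RR : realType) (I : set R) : \bar RR :=
  @length_quot RR R R^o setT I.

End Ideals.

Section Graded.
Variables (k : fieldType) (R : comAlgType k).

Definition is_grading (gr : nat -> set R) : Prop :=
  [/\ forall m, is_submodule (gr m),
      forall m n x y, gr m x -> gr n y -> gr (m + n)%N (x * y),
      forall x : R, exists n (a : nat -> R),
        (forall i, gr i (a i)) /\ x = \sum_(i < n) a i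
    & forall n (a : nat -> R), (forall i, gr i (a i)) ->
        \sum_(i < n) a i = 0 -> forall i, (i < n)%N -> a i = 0].

Definition standard_graded (gr : nat -> set R) : Prop :=
  [/\ noetherian_ring R,
      is_grading gr,
      gr 0%N = range (fun c : k => c%:A)
    & smallest (fun S : set R => GRing.subalg_closed (mem S)) (gr 1%N) = setT].

Definition homogeneous_ideal (gr : nat -> set R) (I : set R) : Prop :=
  is_ideal I /\
  forall n (a : nat -> R), (forall i, gr i (a i)) ->
    I (\sum_(i < n) a i) -> forall i, (i < n)%N -> I (a i).

Definition int_component (gr : nat -> set R) (m : int) : set R :=
  match m with Posz n => gr n | Negz _ => [set 0] end.

(* (R/J)_m is R_m / (J `&` R_m), and its length is taken over R_0 = k. *)
Definition component_length (RR : realType) (gr : nat -> set R) (J : set R)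
    (m : int) : \bar RR :=
  @length_quot RR k R (int_component gr m) (J `&` int_component gr m).

(* The components of a standard graded ring are finite-dimensional over k, so
   fine is only applied to finite values there. *)
Definition HK_fun (RR : realType) (p : nat) (gr : nat -> set R) (I : set R)
    (n : nat) (x : RR) : RR :=
  fine (component_length RR gr (frobenius_power I (p ^ n))
          (Num.floor (x * (p ^ n)%:R))).

Definition HK_density (RR : realType) (p : nat) (gr : nat -> set R) (I : set R)
    (x : RR) : RR :=
  limn (fun n => HK_fun p gr I n x).

(* The normalisation by p ^ n is the one for rings of dimension 1. *)
Definition HK_seq (RR : realType) (p : nat) (I : set R) (n : nat) : \bar RR :=
  (ring_length_quot RR (frobenius_power I (p ^ n)) * ((p ^ n)%:R^-1)%:E)%E.

Definition HK_multiplicity (RR : realType) (p : nat) (I : set R) : \bar RR :=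
  limn (@HK_seq RR p I).

Definition HK_setting (RR : realType) (gr : nat -> set R) (I : set R) : Prop :=
  [/\ standard_graded gr,
      reduced_ring R,
      krull_dim R RR = 1%E,
      homogeneous_ideal gr I
    & (ring_length_quot RR I < +oo)%E].

End Graded.

Arguments HK_fun {k R} RR p gr I n x.
Arguments HK_density {k R} RR p gr I x.
Arguments HK_seq {k R} RR p I n.
Arguments HK_multiplicity {k R} RR p I.

(* Main.v *)
From HB Require Import structures.
Require Import Defs.
From mathcomp Require Import all_boot all_order all_algebra.
From mathcomp Require Import all_classical all_reals all_analysis.
From mathcomp Require Import measurable_realfun measure_negligible.
From mathcomp Require Import zify ring lra.
Import Order.TTheory GRing.Theory Num.Theory.
Import numFieldNormedType.Exports.
Local Open Scope classical_set_scope.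
Local Open Scope ring_scope.

Set Implicit Arguments.
Unset Strict Implicit.
Unset Printing Implicit Defensive.

(* R is reduced of dimension 1, so it has homogeneous nonzerodivisors in every
   large degree and dim R_m is bounded, hence constant for m >= c.  Multiplication
   by such nonzerodivisors identifies the components of R in large degrees, and
   since a and a^q have the same annihilator, a R_(n + (q-1)d) = a^q R_n for all
   homogeneous a of degree d, all q >= 1 and all n >= c, with c independent of q.
   Fix x > 0, put m = floor(xq), and let K be the ideal generated by the I_d with
   d < x.  For large q the component (I^[q])_m is K_m + {a^q | a in I_x}, where
   I_x = 0 unless x is an integer.  Here dim K_m is eventually constant; as k is
   perfect, {a^q | a in I_x} modulo K has the dimension of I_x modulo the subspace
   {a in I_x | a^q in K}, which increases with q.  So f_n(x) is eventually constant.  All f_n are bounded by one constant and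
   vanish outside one interval, and the integral of f_n is the length of
   R / I^[q] divided by q, so dominated convergence gives the formula.
   Uniformity fails for k[X, Y] / (XY) and the ideal (X, Y). *)

(** * Lengths *)

(** Length is a supremum over chains of submodules, so dimensions are compared by isomorphisms of
    ordered sets of submodules. This is what lets Frobenius, which is only semilinear, preserve
    dimension over a perfect field, and what identifies R-length with k-dimension on graded pieces.
    A finite k may leave no nonzerodivisor of degree 1, so one is built in each large degree N.
    Elements b with prime annihilator are collected into a finite orthogonal family that detects
    zero in positive degree. For each b some u_b of degree 1 lies outside ann b, and y = sum of
    u_b^(N - deg b) b works because y b = u_b^(N - deg b) b^2. Dimension 1 enters only through bR, a
    copy of R / ann b: adding u_b to ann b captures all large components, so the dimension of b R_n
    is eventually nonincreasing. *)

Section Height.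
Variable T : Type.
Implicit Types (Q : set T -> Prop) (S : set T).

(** A finite supremum that is attained, so that lengths can be handled as natural numbers;
    [chain_heightE] returns to extended reals. *)
Definition height Q n :=
  (exists C, strict_chain Q n C) /\
  (forall m C, strict_chain Q m C -> (m <= n)%N).

Lemma height_uniq Q m n : height Q m -> height Q n -> m = n.
Proof.
move=> [[C hC] Cm] [[D hD] Dn]; apply/eqP; rewrite eqn_leq.
by rewrite (Dn _ _ hC) (Cm _ _ hD).
Qed.

Lemma chain_heightE (RR : realType) Q n :
  height Q n -> chain_height RR Q = (n%:R)%:E.
Proof.
move=> [hC Cn]; apply/eqP; rewrite eq_le; apply/andP; split.
  apply: ge_ereal_sup => _ [m [C hC']] <-.
  by rewrite lee_fin ler_nat (Cn _ _ hC').
by apply: ereal_sup_ubound; exists n.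
Qed.

Lemma chain_height_bounded (RR : realType) Q :
  (chain_height RR Q < +oo)%E ->
  exists N, forall m C, strict_chain Q m C -> (m <= N)%N.
Proof.
move=> hQ; have h m C : strict_chain Q m C -> ((m%:R)%:E <= chain_height RR Q)%E.
  by move=> hC; apply: ereal_sup_ubound; exists m => //; exists C.
case: (chain_height RR Q) hQ h => [r _ h|//|_ h].
  exists (Num.truncn r) => m C /h; rewrite lee_fin => hm.
  by rewrite truncn_ge_nat // (le_trans _ hm).
by exists 0%N => m C /h.
Qed.

Lemma rank_bound Q (rho : set T -> nat) n :
    (forall S, Q S -> (rho S <= n)%N) ->
    (forall S S', Q S -> Q S' -> S `<` S' -> (rho S < rho S')%N) ->
  forall m C, strict_chain Q m C -> (m <= n)%N.
Proof.
move=> rn rlt m C [QC ltC].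
suff h i : (i <= m)%N -> (i <= rho (C i))%N.
  by apply: leq_trans (rn _ (QC m (leqnn m))); exact: h.
elim: i => // i IH im; apply: (leq_ltn_trans (IH (ltnW im))).
by apply: rlt; [apply: QC; exact: ltnW|exact: QC|exact: ltC].
Qed.

(** Converse of [rank_bound]. The rank of [S] is the length of the longest chain whose last member
    lies in [S]; if [S] is strictly inside [S'], appending [S'] to that chain makes it longer. *)
Lemma bounded_rank Q n :
    (forall m C, strict_chain Q m C -> (m <= n)%N) ->
  exists rho : set T -> nat, (forall S, Q S -> (rho S <= n)%N) /\
    (forall S S', Q S -> Q S' -> S `<` S' -> (rho S < rho S')%N).
Proof.
move=> hn.
pose P S m := exists C, strict_chain Q m C /\ C m `<=` S.
have [rho hrho] : exists rho : set T -> nat, forall S, Q S ->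
    P S (rho S) /\ forall m, P S m -> (m <= rho S)%N.
  suff /choice[rho ?] : forall S, exists r, Q S ->
      P S r /\ forall m, P S m -> (m <= r)%N by exists rho.
  move=> S; have [QS|] := pselect (Q S); last by exists 0%N.
  have ex : exists m, `[< P S m >].
    by exists 0%N; apply/asboolP; exists (fun=> S); split=> //; split.
  have ub m : `[< P S m >] -> (m <= n)%N.
    by move=> /asboolP[C [/hn]].
  exists (ex_maxn ex ub); case: ex_maxnP => m /asboolP Pm hm; split=> // m' Pm'.
  by apply: hm; apply/asboolP.
exists rho; split=> [S QS|S S' QS QS' SS'].
  by have [[C [/hn]]] := hrho _ QS.
have [[C [[QC ltC] CS]] _] := hrho _ QS.
have [_] := hrho _ QS'; apply.
exists (fun i => if (i <= rho S)%N then C i else S'); split; last by rewrite ltnn.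
split=> [i _|i]; first by case: ifP => // /QC.
rewrite ltnS => ile; rewrite ile; case: ifPn => [/ltC//|].
rewrite -leqNgt => rle; have -> : i = rho S by apply/eqP; rewrite eqn_leq ile rle.
case: SS' => sub nsub; split; first exact: (subset_trans CS).
by move=> S'C; apply: nsub; exact: subset_trans CS.
Qed.

Lemma bounded_height Q n S : Q S ->
    (forall m C, strict_chain Q m C -> (m <= n)%N) ->
  exists2 m, height Q m & (m <= n)%N.
Proof.
move=> QS hn.
have ex : exists m, `[< exists C, strict_chain Q m C >].
  by exists 0%N; apply/asboolP; exists (fun=> S); split.
have ub m : `[< exists C, strict_chain Q m C >] -> (m <= n)%N.
  by move=> /asboolP[C /hn].
case: (ex_maxnP ex ub) => m /asboolP[C hC] hm; exists m.
  split; first by exists C.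
  by move=> j D hD; apply: hm; apply/asboolP; exists D.
exact: hn hC.
Qed.

End Height.

Lemma strict_chain_map (T T' : Type) (Q : set T -> Prop) (Q' : set T' -> Prop)
    (f : set T -> set T') n C :
    (forall S, Q S -> Q' (f S)) ->
    (forall S S', Q S -> Q S' -> S `<` S' -> f S `<` f S') ->
  strict_chain Q n C -> strict_chain Q' n (f \o C).
Proof.
move=> fQ flt [QC ltC]; split=> i hi; first exact/fQ/QC.
apply: flt; [apply: QC; exact: ltnW|exact: QC|exact: ltC].
Qed.

(** Only the inclusion order matters, so this also compares modules over different rings and
    transports lengths along maps that are not linear. *)
Lemma height_iso (T T' : Type) (Q : set T -> Prop) (Q' : set T' -> Prop)
    (f : set T -> set T') (g : set T' -> set T) n :
    (forall S, Q S -> Q' (f S)) -> (forall S, Q' S -> Q (g S)) ->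
    (forall S S', S `<=` S' -> f S `<=` f S') ->
    (forall S S', S `<=` S' -> g S `<=` g S') ->
    (forall S, Q S -> g (f S) = S) -> (forall S, Q' S -> f (g S) = S) ->
  height Q n <-> height Q' n.
Proof.
move=> fQ gQ fm gm gf fg.
have flt S S' : Q S -> Q S' -> S `<` S' -> f S `<` f S'.
  move=> QS QS' [le nle]; split; first exact: fm.
  by move=> /gm; rewrite !gf.
have glt S S' : Q' S -> Q' S' -> S `<` S' -> g S `<` g S'.
  move=> QS QS' [le nle]; split; first exact: gm.
  by move=> /fm; rewrite !fg.
split=> -[[C hC] hn]; split.
- by exists (f \o C); exact: strict_chain_map fQ flt hC.
- by move=> m D /(strict_chain_map gQ glt)/hn.
- by exists (g \o C); exact: strict_chain_map gQ glt hC.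
- by move=> m D /(strict_chain_map fQ flt)/hn.
Qed.

Definition sumset (V : zmodType) (M N : set V) : set V :=
  [set x | exists u v, [/\ M u, N v & x = u + v]].

(** * Submodules and additivity of length *)

Section Modules.
Variables (A : nzRingType) (V : lmodType A).
Implicit Types M N P S : set V.

Lemma submoduleP S :
  is_submodule S <-> S 0 /\ forall a u v, S u -> S v -> S (a *: u + v).
Proof.
split=> -[S0 Sl].
  split=> [|a u v Su Sv]; first by move: S0; rewrite inE.
  by have := Sl a u v (mem_set Su) (mem_set Sv); rewrite inE.
split=> [|a u v]; first by rewrite inE.
by rewrite !inE; exact: Sl.
Qed.

Lemma submod0 S : is_submodule S -> S 0.
Proof. by case/submoduleP. Qed.

Lemma sub0_submod S : is_submodule S -> [set 0] `<=` S.
Proof. by move=> hS _ ->; exact: submod0. Qed.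

Lemma submodD S u v : is_submodule S -> S u -> S v -> S (u + v).
Proof. by case/submoduleP=> _ h Su Sv; rewrite -[u]scale1r; exact: h. Qed.

Lemma submodZ S a u : is_submodule S -> S u -> S (a *: u).
Proof. by case/submoduleP=> S0 h Su; rewrite -[_ *: _]addr0; exact: h. Qed.

Lemma submodN S u : is_submodule S -> S u -> S (- u).
Proof. by move=> hS Su; rewrite -scaleN1r; exact: submodZ. Qed.

Lemma submodB S u v : is_submodule S -> S u -> S v -> S (u - v).
Proof. by move=> hS Su Sv; apply: submodD => //; exact: submodN. Qed.

Lemma submod_sum S (I : Type) (r : seq I) (P : pred I) (F : I -> V) :
  is_submodule S -> (forall i, P i -> S (F i)) -> S (\sum_(i <- r | P i) F i).
Proof.
move=> hS hF; elim/big_ind: _ => // [|u v]; [exact: submod0|exact: submodD].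
Qed.

Lemma submodule_set0 : is_submodule [set (0 : V)].
Proof. by apply/submoduleP; split=> // a u v -> ->; rewrite scaler0 addr0. Qed.

Lemma submoduleI M N : is_submodule M -> is_submodule N -> is_submodule (M `&` N).
Proof.
move=> /submoduleP[M0 hM] /submoduleP[N0 hN]; apply/submoduleP; split=> //.
by move=> a u v [Mu Nu] [Mv Nv]; split; [exact: hM|exact: hN].
Qed.

Lemma submodule_sumset M N :
  is_submodule M -> is_submodule N -> is_submodule (sumset M N).
Proof.
move=> hM hN; apply/submoduleP; split.
  by exists 0, 0; split; [exact: submod0|exact: submod0|rewrite addr0].
move=> a _ _ [u [v [Mu Nv ->]]] [u' [v' [Mu' Nv' ->]]].
exists (a *: u + u'), (a *: v + v'); split.
- by apply: submodD => //; exact: submodZ.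
- by apply: submodD => //; exact: submodZ.
- by rewrite scalerDr addrACA.
Qed.

Lemma sumset_subl M N : is_submodule N -> M `<=` sumset M N.
Proof. by move=> hN u Mu; exists u, 0; split; rewrite ?addr0//; exact: submod0. Qed.

Lemma sumset_subr M N : is_submodule M -> N `<=` sumset M N.
Proof. by move=> hM u Mu; exists 0, u; split; rewrite ?add0r//; exact: submod0. Qed.

Lemma sumset_sub M N P :
  is_submodule P -> M `<=` P -> N `<=` P -> sumset M N `<=` P.
Proof. by move=> hP MP NP _ [u [v [/MP Pu /NP Pv ->]]]; exact: submodD. Qed.

Definition between N P S := [/\ is_submodule S, N `<=` S & S `<=` P].

Definition flen P N n := height (between N P) n.

Lemma length_quotE (RR : realType) P N n :
  flen P N n -> length_quot RR P N = (n%:R)%:E.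
Proof. exact: chain_heightE. Qed.

Lemma flen_uniq P N m n : flen P N m -> flen P N n -> m = n.
Proof. exact: height_uniq. Qed.

Lemma flen_self P : is_submodule P -> flen P P 0.
Proof.
move=> hP; split; first by exists (fun=> P); split=> // i _; split.
move=> [//|m] C [QC /(_ 0%N isT)[_]]; case.
have [_ _ h] := QC 1%N isT; have [_ h' _] := QC 0%N isT.
exact: subset_trans h'.
Qed.

(** Two chains are concatenated at [M] for the lower bound. For the upper bound, ranks on the two
    intervals combine into the rank of [S] meet [M] plus the rank of [S + M]. *)
Lemma flen_add P M N m n :
  N `<=` M -> M `<=` P -> is_submodule M -> is_submodule P ->
  flen P M m -> flen M N n -> flen P N (n + m).
Proof.
move=> NM MP hM hP [[C [QC ltC]] Cm] [[D [QD ltD]] Dn]; split.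
  exists (fun i => if (i <= n)%N then D i else C (i - n)%N); split=> [i ilt|i ilt].
    case: ifP => [/QD[? ? h]|ni]; first by split=> //; exact: subset_trans MP.
    have /QC[? h ?]: (i - n <= m)%N by lia.
    by split=> //; exact: subset_trans h.
  case: ifP => ni; case: ifP => ni'; [exact: ltD| |lia|].
    have e : i = n by lia.
    have -> : (i.+1 - n = 1)%N by lia.
    have /ltC[s ns] : (0 < m)%N by lia.
    have [_ _ h1] := QD i ni; have [_ h2 _] := QC 0%N isT.
    split; first by apply: subset_trans s; exact: subset_trans h2.
    by move=> h; apply: ns; apply: (subset_trans h); exact: subset_trans h2.
  have -> : (i.+1 - n = (i - n).+1)%N by lia.
  by apply: ltC; lia.
have [r1 [r1n r1lt]] := bounded_rank Dn.
have [r2 [r2m r2lt]] := bounded_rank Cm.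
have Q1 S : between N P S -> between N M (S `&` M).
  move=> [hS NS SP]; split; [exact: submoduleI| |exact: subIsetr].
  by move=> x Nx; split; [exact: NS|exact: NM].
have Q2 S : between N P S -> between M P (sumset S M).
  move=> [hS NS SP]; split; [exact: submodule_sumset|exact: sumset_subr|].
  exact: sumset_sub hP SP MP.
apply: (rank_bound (rho := fun S => (r1 (S `&` M) + r2 (sumset S M))%N)).
  by move=> S QS; apply: leq_add; [apply: r1n; exact: Q1|apply: r2m; exact: Q2].
move=> S S' QS QS' [SS' nSS'].
have le_rank (Q : set V -> Prop) (r : set V -> nat) X Y :
    (forall X Y, Q X -> Q Y -> X `<` Y -> (r X < r Y)%N) ->
    Q X -> Q Y -> X `<=` Y -> (r X <= r Y)%N.
  move=> rlt QX QY XY; have [YX|nYX] := pselect (Y `<=` X).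
    by have -> : X = Y by apply/seteqP.
  by apply/ltnW/rlt.
(* Modular law: when [S] and [S'] have the same intersection with [M], their sums with [M] must
   differ, so one of the two ranks increases strictly. *)
have [hI|hI] := pselect (S' `&` M `<=` S `&` M); last first.
  rewrite -addSn; apply: leq_add; last first.
    apply: (le_rank _ _ _ _ r2lt); [exact: Q2|exact: Q2|].
    by move=> _ [u [v [/SS' Su Mv ->]]]; exists u, v.
  apply: r1lt; [exact: Q1|exact: Q1|split=> //].
  by move=> x [/SS' ? ?].
rewrite -addnS; apply: leq_add.
  apply: (le_rank _ _ _ _ r1lt); [exact: Q1|exact: Q1|].
  by move=> x [/SS' ? ?].
apply: r2lt; [exact: Q2|exact: Q2|split].
  by move=> _ [u [v [/SS' Su Mv ->]]]; exists u, v.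
move=> h; apply: nSS' => x S'x.
case: QS => hS _ _; case: QS' => hS' _ _.
have [u [v [Su Mv e]]] : sumset S M x by apply: h; exact: sumset_subl.
have S'v : S' v.
  have -> : v = x - u by rewrite e addrC addKr.
  by apply: submodB => //; exact: SS'.
by rewrite e; apply: submodD => //; have [] := hI v.
Qed.

Lemma flen_between P M N n : N `<=` M -> M `<=` P ->
    is_submodule P -> is_submodule M -> is_submodule N ->
    flen P N n ->
  exists a b, [/\ flen P M a, flen M N b & n = (b + a)%N].
Proof.
move=> NM MP hP hM hN hn; have [_ bn] := hn.
have bl Q S : Q S -> (forall S, Q S -> between N P S) ->
    exists a, height Q a.
  move=> QS h; have [m C hC|m] := @bounded_height _ Q n S QS; last by exists m.
  apply: (bn m C); case: hC => QC ltC; split=> // i /QC; exact: h.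
have [a ha] : exists a, flen P M a.
  apply: (bl _ M) => [//|S [hS MS SP]]; split=> //; exact: subset_trans MS.
have [b hb] : exists b, flen M N b.
  apply: (bl _ M) => [//|S [hS NS SM]]; split=> //; exact: subset_trans MP.
by exists a, b; split=> //; apply: flen_uniq hn _; exact: (flen_add NM MP).
Qed.

Lemma flen0_eq P M : is_submodule P -> is_submodule M -> M `<=` P ->
  flen P M 0 -> P = M.
Proof.
move=> hP hM MP [_ h]; apply/seteqP; split=> // x Px; apply: contrapT => nMx.
suff : (1 <= 0)%N by [].
apply: (h 1%N (fun i => if i == 0%N then M else P)); split.
  by move=> i _; case: (i == 0%N); split.
by case=> // _; split=> // /(_ _ Px).
Qed.

(** Second isomorphism theorem: intersecting with [M] and adding [N] are inverse to each other on
    the two intervals. *)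
Lemma flen_sumset M N n : is_submodule M -> is_submodule N ->
  flen (sumset M N) N n <-> flen M (M `&` N) n.
Proof.
move=> hM hN; apply: (height_iso (f := fun S => S `&` M) (g := fun S => sumset S N)).
- move=> S [hS NS SP]; split; [exact: submoduleI| |exact: subIsetr].
  by move=> x [Mx /NS].
- move=> S [hS NS SP]; split; [exact: submodule_sumset|exact: sumset_subr|].
  by move=> _ [u [v [/SP Su Mv ->]]]; exists u, v.
- by move=> S S' SS' x [/SS' ? ?].
- by move=> S S' SS' _ [u [v [/SS' ? ? ->]]]; exists u, v.
- move=> S [hS NS SP]; apply/seteqP; split.
    by apply: sumset_sub => // x [].
  move=> x Sx; have [u [v [Mu Nv e]]] := SP _ Sx; exists u, v; split=> //.
  split=> //; have -> : u = x - v by rewrite e addrK.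
  by apply: submodB => //; exact: NS.
- move=> S [hS NS SP]; apply/seteqP; split.
    move=> x [[u [v [Su Nv e]]] Mx]; rewrite e; apply: submodD => //.
    apply: NS; split=> //; have -> : v = x - u by rewrite e addrC addKr.
    by apply: submodB => //; exact: SP.
  by move=> x Sx; split; [exact: sumset_subl|exact: SP].
Qed.

Definition flen_fin P := exists n, flen P [set 0] n.

Lemma flen_fin_sub P M : is_submodule P -> is_submodule M -> M `<=` P ->
  flen_fin P -> flen_fin M.
Proof.
move=> hP hM MP [n hn].
have [a [b [_ ? _]]] :=
  flen_between (sub0_submod hM) MP hP hM submodule_set0 hn.
by exists b.
Qed.

Lemma flen_fin_sumset M N : is_submodule M -> is_submodule N ->
  flen_fin M -> flen_fin N -> flen_fin (sumset M N).
Proof.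
move=> hM hN [m hm] [n hn].
have [a [b [ha _ _]]] := flen_between (M := M `&` N) (N := [set 0])
  (sub0_submod (submoduleI hM hN)) (@subIsetl _ _ _) hM (submoduleI hM hN)
  submodule_set0 hm.
exists (n + a)%N; apply: (flen_add (M := N)) => //.
- exact: sub0_submod.
- exact: sumset_subr.
- exact: submodule_sumset.
- exact/flen_sumset.
Qed.

Lemma flen_set0 : flen [set 0] [set 0] 0.
Proof. exact: flen_self submodule_set0. Qed.

Section Image.
Variables (phi : V -> V) (P N : set V).
Hypotheses (hP : is_submodule P) (hN : is_submodule N) (NP : N `<=` P).
Hypothesis phiB : forall u v, phi (u - v) = phi u - phi v.
Hypothesis phi_image : forall S, is_submodule S -> S `<=` P ->
  is_submodule (phi @` S).
Hypothesis phi_preimage : forall S, is_submodule S ->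
  is_submodule (P `&` phi @^-1` S).
Hypothesis phi_ker : forall u, P u -> phi u = 0 -> N u.

(** Instead of linearity, [phi] is assumed additive and compatible with submodules under image and
    preimage. This covers both multiplication by an element and the semilinear Frobenius. *)
Lemma flen_image n : flen (phi @` P) (phi @` N) n <-> flen P N n.
Proof.
symmetry; apply: (height_iso (f := fun S => phi @` S)
  (g := fun S => P `&` phi @^-1` S)).
- move=> S [hS NS SP]; split; [exact: phi_image| |].
    by move=> _ [u /NS Su <-]; exists u.
  by move=> _ [u /SP Su <-]; exists u.
- move=> S [hS NS SP]; split; [exact: phi_preimage| |exact: subIsetl].
  by move=> u Nu; split; [exact: NP|apply: NS; exists u].
- by move=> S S' SS' _ [u /SS' Su <-]; exists u.
- by move=> S S' SS' u [Pu /SS' Su].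
- move=> S [hS NS SP]; apply/seteqP; split=> [u [Pu [v Sv e]]|u Su]; last first.
    by split; [exact: SP|exists u].
  rewrite -(subrK v u); apply: submodD => //; apply: NS; apply: phi_ker.
    by apply: submodB => //; exact: SP.
  by rewrite phiB e subrr.
- move=> S [hS NS SP]; apply/seteqP; split=> [_ [u [Pu Su] <-]//|x Sx].
  by have [u Pu e] := SP _ Sx; exists u => //; split=> //; rewrite /= e.
Qed.

End Image.

(** The default 0 is the value at infinite length, which is why [flen_fin] accompanies [len]
    below. *)
Definition len P : nat := xget 0%N [set n | flen P [set 0] n].

Lemma lenP P : flen_fin P -> flen P [set 0] (len P).
Proof. by move=> h; rewrite /len; case: xgetP => [n _ //|] => h'; case: h => n /h'. Qed.

Lemma len_flen P n : flen P [set 0] n -> len P = n.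
Proof. by move=> h; apply: (@flen_uniq P [set 0]) => //; apply: lenP; exists n. Qed.

Lemma flen_lenB P N : is_submodule P -> is_submodule N -> N `<=` P ->
  flen_fin P -> (len N <= len P)%N /\ flen P N (len P - len N).
Proof.
move=> hP hN NP /lenP hl.
have [a [b [ha /len_flen hb e]]] :=
  flen_between (sub0_submod hN) NP hP hN submodule_set0 hl.
by rewrite hb e addKn leq_addr.
Qed.

Lemma len_le P N : is_submodule P -> is_submodule N -> N `<=` P ->
  flen_fin P -> (len N <= len P)%N.
Proof. by move=> hP hN NP /(flen_lenB hP hN NP)[]. Qed.

Lemma len_eq P N : is_submodule P -> is_submodule N -> N `<=` P ->
  flen_fin P -> len N = len P -> N = P.
Proof.
move=> hP hN NP fP e; have [_] := flen_lenB hP hN NP fP.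
by rewrite e subnn => /(flen0_eq hP hN NP).
Qed.

Lemma len_sumset M N : is_submodule M -> is_submodule N ->
  flen_fin M -> flen_fin N ->
  len (sumset M N) = (len N + (len M - len (M `&` N)))%N.
Proof.
move=> hM hN fM fN; have hI := submoduleI hM hN.
have [_ h] := flen_lenB hM hI (@subIsetl _ _ _) fM.
apply: len_flen; apply: (flen_add (M := N)).
- exact: sub0_submod.
- exact: sumset_subr.
- by [].
- exact: submodule_sumset.
- exact/flen_sumset.
- exact: lenP.
Qed.

Lemma len_set0 : len [set 0] = 0%N.
Proof. exact/len_flen/flen_set0. Qed.

End Modules.

(** * Ideals of Noetherian rings *)

Section IdealTheory.
Variable R : comNzRingType.
Implicit Types I J : set R.

Lemma idealP I :
  is_ideal I <-> I 0 /\ forall a u v, I u -> I v -> I (a * u + v).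
Proof. exact: submoduleP. Qed.

Lemma ideal0 I : is_ideal I -> I 0.
Proof. exact: submod0. Qed.

Lemma idealD I u v : is_ideal I -> I u -> I v -> I (u + v).
Proof. exact: submodD. Qed.

Lemma idealB I u v : is_ideal I -> I u -> I v -> I (u - v).
Proof. exact: submodB. Qed.

Lemma ideal_mulr I a u : is_ideal I -> I u -> I (a * u).
Proof. exact: submodZ. Qed.

Lemma ideal_mull I a u : is_ideal I -> I u -> I (u * a).
Proof. by rewrite mulrC; exact: ideal_mulr. Qed.

Lemma ideal_sum I (K : Type) (r : seq K) (P : pred K) (F : K -> R) :
  is_ideal I -> (forall i, P i -> I (F i)) -> I (\sum_(i <- r | P i) F i).
Proof. exact: submod_sum. Qed.

Lemma ideal_sumset I J : is_ideal I -> is_ideal J -> is_ideal (sumset I J).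
Proof. exact: submodule_sumset. Qed.

Lemma ideal_sumset_subl I J : is_ideal J -> I `<=` sumset I J.
Proof. exact: sumset_subl. Qed.

Lemma ideal_sumset_subr I J : is_ideal I -> J `<=` sumset I J.
Proof. exact: sumset_subr. Qed.

Lemma is_prime_idealP (P : set R) : is_prime_ideal P <->
  [/\ is_ideal P, ~ P 1 & forall u v, P (u * v) -> P u \/ P v].
Proof.
split=> [[[P0 P1 Pl] Pp]|[hP P1 Pp]].
  split.
  - apply/idealP; move: P0; rewrite inE => P0; split=> // a u v Pu Pv.
    by have := Pl a u v; rewrite !inE; apply.
  - by move=> h; move/negP: P1; apply; rewrite inE.
  - by move=> u v Puv; have := Pp u v; rewrite !inE => /(_ Puv) /orP[]; rewrite inE; auto.
split.
  split; [by rewrite inE; exact: ideal0|by apply/negP; rewrite inE|].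
  by move=> a u v; rewrite !inE => Pu Pv; apply: idealD => //; exact: ideal_mulr.
by move=> u v; rewrite !inE => /Pp[] h; apply/orP; [left|right]; rewrite inE.
Qed.

Definition ann (b : R) : set R := [set r | r * b = 0].

Lemma ideal_ann b : is_ideal (ann b).
Proof.
apply/idealP; split; first by rewrite /ann /= mul0r.
by move=> a u v hu hv; rewrite /ann /= mulrDl -mulrA hu hv mulr0 addr0.
Qed.

Definition principal (b : R) : set R := [set b * r | r in setT].

Lemma ideal_principal b : is_ideal (principal b).
Proof.
apply/idealP; split; first by exists 0; rewrite ?mulr0.
by move=> a _ _ [u _ <-] [v _ <-]; exists (a * u + v) => //; ring.
Qed.

Lemma ideal_gen_ideal (A : set R) : is_ideal (ideal_gen A).
Proof.
apply/idealP; split; first by move=> J [/ideal0].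
move=> a u v hu hv J hJ; have [h _] := hJ.
by apply: idealD; [|apply: ideal_mulr => //; exact: hu|exact: hv].
Qed.

Lemma sub_ideal_gen (A : set R) : A `<=` ideal_gen A.
Proof. by move=> x Ax J [_]; apply. Qed.

Lemma ideal_gen_min (A J : set R) : is_ideal J -> A `<=` J -> ideal_gen A `<=` J.
Proof. by move=> hJ AJ x; apply; split. Qed.

(** [P] need not be stable under multiplication: the elements all of whose multiples satisfy [P]
    form an ideal containing [A]. *)
Lemma ideal_gen_ind (A : set R) (P : R -> Prop) :
    P 0 -> (forall u v, P u -> P v -> P (u + v)) ->
    (forall r a, A a -> P (r * a)) ->
  forall x, ideal_gen A x -> P x.
Proof.
move=> P0 PD PA x hx; rewrite -[x]mul1r; move: 1.
apply: (ideal_gen_min (J := [set x | forall r, P (r * x)])) hx.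
  apply/idealP; split=> [r|a u v hu hv r /=]; first by rewrite mulr0.
  by rewrite mulrDr mulrA; exact: PD.
by move=> a Aa r; exact: PA.
Qed.

Lemma ideal_gen_seqP (s : seq R) x :
  ideal_gen [set` s] x -> exists r : R -> R, x = \sum_(u <- undup s) u * r u.
Proof.
move: x; apply: (@ideal_gen_ind _ (fun x => exists r : R -> R, x = \sum_(u <- undup s) u * r u)).
- by exists (fun=> 0); rewrite big1 // => u _; rewrite mulr0.
- move=> _ _ [c ->] [d ->]; exists (fun u => c u + d u).
  by rewrite -big_split; apply: eq_bigr => u _; rewrite mulrDr.
- move=> r a /= sa; exists (fun u => if u == a then r else 0).
  rewrite (bigD1_seq a) ?undup_uniq ?mem_undup //= eqxx big1 ?addr0 1?mulrC //.
  by move=> u /negPf ->; rewrite mulr0.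
Qed.

Lemma ideal_gen_finite (A : set R) x : ideal_gen A x ->
  exists s : seq R, [set` s] `<=` A /\ ideal_gen [set` s] x.
Proof.
move: x; apply: (@ideal_gen_ind _ (fun x => exists s : seq R, [set` s] `<=` A /\
  ideal_gen [set` s] x)).
- exists [::]; split; first by move=> y; rewrite /= in_nil.
  exact: (ideal0 (ideal_gen_ideal _)).
- move=> u v [s [sA hu]] [t [tA hv]]; exists (s ++ t); split.
    by move=> x0 /=; rewrite mem_cat => /orP[/sA|/tA].
  apply: (idealD (ideal_gen_ideal _)).
    apply: ideal_gen_min hu; first exact: ideal_gen_ideal.
    by move=> y ys; apply: sub_ideal_gen; rewrite /= mem_cat ys.
  apply: ideal_gen_min hv; first exact: ideal_gen_ideal.
  by move=> y ys; apply: sub_ideal_gen; rewrite /= mem_cat ys orbT.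
- move=> r a Aa; exists [:: a]; split; first by move=> y /=; rewrite inE => /eqP ->.
  apply: (ideal_mulr _ (ideal_gen_ideal _)).
  by apply: sub_ideal_gen; rewrite /= mem_head.
Qed.

Hypothesis noethR : noetherian_ring R.

(** The finite generating set given by Noetherianity need not lie in [A], but each of its members
    involves only finitely many elements of [A]. *)
Lemma noetherian_gen (A : set R) :
  exists s : seq R, [set` s] `<=` A /\ ideal_gen A = ideal_gen [set` s].
Proof.
have [t et] := noethR (ideal_gen_ideal A).
suff [s [sA ts]] : exists s : seq R, [set` s] `<=` A /\
    forall x, x \in t -> ideal_gen [set` s] x.
  exists s; split=> //; apply/seteqP; split.
    by rewrite et; apply: ideal_gen_min => //; exact: ideal_gen_ideal.
  apply: ideal_gen_min; first exact: ideal_gen_ideal.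
  by move=> x /sA; exact: sub_ideal_gen.
have : forall x, x \in t -> ideal_gen A x.
  by move=> x xt; rewrite et; exact: sub_ideal_gen.
elim: t {et} => [_|x t IH h]; first by exists [::].
have [|s [sA ts]] := IH; first by move=> y yt; apply: h; rewrite inE yt orbT.
have [s' [s'A xs']] := ideal_gen_finite (h x (mem_head _ _)).
exists (s ++ s'); split; first by move=> y /=; rewrite mem_cat => /orP[/sA|/s'A].
have sub1 : ideal_gen [set` s] `<=` ideal_gen [set` s ++ s'].
  apply: ideal_gen_min; first exact: ideal_gen_ideal.
  by move=> y ys; apply: sub_ideal_gen; rewrite /= mem_cat ys.
have sub2 : ideal_gen [set` s'] `<=` ideal_gen [set` s ++ s'].
  apply: ideal_gen_min; first exact: ideal_gen_ideal.
  by move=> y ys; apply: sub_ideal_gen; rewrite /= mem_cat ys orbT.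
move=> y; rewrite inE => /orP[/eqP ->|/ts]; [exact: sub2|exact: sub1].
Qed.

Lemma noetherian_max (Phi : set R -> Prop) J0 :
    Phi J0 -> (forall J, Phi J -> is_ideal J) ->
  exists J, [/\ Phi J & forall J', Phi J' -> J `<=` J' -> J' `<=` J].
Proof.
move=> hJ0 hPhi.
have [F FP tF|Q [[->|hQ] maxQ]] := @Zorn_bigcup R [set J | J = set0 \/ Phi J].
- have [[J [FJ nJ]]|h] := pselect (exists J, F J /\ J <> set0); last first.
    left; rewrite -subset0 => x [J FJ Jx]; apply: h.
    by exists J; split=> // e; move: Jx; rewrite e.
  have nz J' : F J' -> J' <> set0 -> Phi J' by move=> /FP[].
  have iU : is_ideal (\bigcup_(X in F) X).
    apply/idealP; split; first by exists J => //; exact: (ideal0 (hPhi _ (nz _ FJ nJ))).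
    move=> a u v [X FX Xu] [Y FY Yv].
    have hX : is_ideal X by apply/hPhi/nz => // e; rewrite e in Xu.
    have hY : is_ideal Y by apply/hPhi/nz => // e; rewrite e in Yv.
    have [XY|YX] := tF _ _ FX FY.
      by exists Y => //; apply: idealD => //; apply: ideal_mulr => //; exact: XY.
    by exists X => //; apply: idealD => //; [exact: ideal_mulr|exact: YX].
  have [s es] := noethR iU.
  suff [X [FX nX sX]] : exists X, [/\ F X, X <> set0 & [set` s] `<=` X].
    right; suff -> : \bigcup_(X in F) X = X by exact: nz.
    apply/seteqP; split; last by move=> x Xx; exists X.
    by rewrite es; apply: ideal_gen_min => //; exact/hPhi/nz.
  have : forall x, x \in s -> (\bigcup_(X in F) X) x.
    by move=> x xs; rewrite es; exact: sub_ideal_gen.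
  elim: s {es} => [_|x s IH h]; first by exists J; split.
  have [|X [FX nX sX]] := IH; first by move=> y ys; apply: h; rewrite inE ys orbT.
  have [Y FY Yx] := h x (mem_head _ _).
  have [XY|YX] := tF _ _ FX FY.
    exists Y; split=> //; first by move=> e; rewrite e in Yx.
    by move=> y /=; rewrite inE => /orP[/eqP ->//|/sX]; exact: XY.
  exists X; split=> //.
  by move=> y /=; rewrite inE => /orP[/eqP ->|/sX//]; exact: YX.
- have h0 := ideal0 (hPhi _ hJ0).
  case: (maxQ J0); last by right.
  by split=> // /(_ _ h0).
- exists Q; split=> // J' hJ' QJ'; apply: contrapT => nJ'.
  by apply: (maxQ J'); [split|right].
Qed.

End IdealTheory.

(** * Gradings *)

Section Grading.
Variables (k : fieldType) (R : comAlgType k) (gr : nat -> set R).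
Hypothesis grading : is_grading gr.

Lemma gr_submod m : is_submodule (gr m).
Proof. by case: grading. Qed.

Lemma grM m n x y : gr m x -> gr n y -> gr (m + n)%N (x * y).
Proof. by case: grading => _ h _ _; exact: h. Qed.

Lemma gr_sum_uniq n m (a b : nat -> R) :
    (forall i, gr i (a i)) -> (forall i, gr i (b i)) ->
    \sum_(i < n) a i = \sum_(i < m) b i ->
  forall i, (if (i < n)%N then a i else 0) = (if (i < m)%N then b i else 0).
Proof.
move=> ga gb e i.
have [_ _ _ uniq] := grading.
pose c i := (if (i < n)%N then a i else 0) - (if (i < m)%N then b i else 0).
have trunc p (d : nat -> R) q : (p <= q)%N ->
    \sum_(j < p) d j = \sum_(j < q) if (j < p)%N then d j else 0.
  move=> pq; rewrite -[RHS]big_mkcond /=.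
  by rewrite (big_ord_widen_cond q predT d pq).
have : \sum_(j < (maxn (maxn n m) i.+1)) c j = 0.
  by rewrite sumrB -!trunc ?e ?subrr // !leq_max leqnn ?orbT.
move/(uniq _ c) => h; apply/eqP; rewrite -subr_eq0; apply/eqP.
apply: h; last by rewrite leq_max leqnn orbT.
move=> j; apply: (submodB (gr_submod j)); case: ifP => _ //.
  exact: (submod0 (gr_submod j)).
exact: (submod0 (gr_submod j)).
Qed.

Lemma gr_proj_ex : exists pr : nat -> R -> R,
  [/\ forall i x, gr i (pr i x),
      forall x n (a : nat -> R), (forall i, gr i (a i)) ->
        x = \sum_(i < n) a i -> forall i, pr i x = if (i < n)%N then a i else 0
    & forall x, exists n, forall m, (n <= m)%N -> x = \sum_(i < m) pr i x].
Proof.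
have [_ _ dec _] := grading.
have [f hf] := choice dec; have [g hg] := choice hf.
pose pr i x := if (i < f x)%N then g x i else 0.
have prE x n (a : nat -> R) : (forall i, gr i (a i)) ->
    x = \sum_(i < n) a i -> forall i, pr i x = if (i < n)%N then a i else 0.
  move=> ga e i; rewrite /pr; have [gg eg] := hg x.
  by apply: gr_sum_uniq => //; rewrite -eg.
exists pr; split=> // [i x|x].
  by rewrite /pr; case: ifP => _; [case: (hg x)|exact: (submod0 (gr_submod i))].
exists (f x) => m fm; have [gg {1}->] := hg x.
rewrite (big_ord_widen_cond m predT _ fm) big_mkcond /=.
by apply: eq_bigr.
Qed.

Definition pr := projT1 (cid gr_proj_ex).

Lemma gr_pr i x : gr i (pr i x).
Proof. by have [h _ _] := projT2 (cid gr_proj_ex); exact: h. Qed.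

Lemma prE x n (a : nat -> R) : (forall i, gr i (a i)) ->
  x = \sum_(i < n) a i -> forall i, pr i x = if (i < n)%N then a i else 0.
Proof. by have [_ h _] := projT2 (cid gr_proj_ex); exact: h. Qed.

Lemma pr_sum x : exists n, forall m, (n <= m)%N -> x = \sum_(i < m) pr i x.
Proof. by have [_ _ h] := projT2 (cid gr_proj_ex); exact: h. Qed.

Lemma pr_lin i a x y : pr i (a *: x + y) = a *: pr i x + pr i y.
Proof.
have [n hn] := pr_sum x; have [m hm] := pr_sum y.
pose N := maxn (maxn n m) i.+1.
rewrite (@prE _ N (fun i => a *: pr i x + pr i y)); last 2 first.
- by move=> j; apply: (submodD (gr_submod j)); [apply: (submodZ _ (gr_submod j))|]; exact: gr_pr.
- rewrite big_split /= -scaler_sumr -hn -?hm // /N; lia.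
by have -> : (i < N)%N by rewrite /N; lia.
Qed.

Lemma pr0 i : pr i 0 = 0.
Proof. by have := pr_lin i (-1) 0 0; rewrite scaler0 addr0 scaleN1r addNr. Qed.

Lemma prD i x y : pr i (x + y) = pr i x + pr i y.
Proof. by have := pr_lin i 1 x y; rewrite !scale1r. Qed.

Lemma prZ i a x : pr i (a *: x) = a *: pr i x.
Proof. by have := pr_lin i a x 0; rewrite !addr0 pr0 addr0. Qed.

Lemma pr_bigsum i (I : Type) (r : seq I) (P : pred I) (F : I -> R) :
  pr i (\sum_(j <- r | P j) F j) = \sum_(j <- r | P j) pr i (F j).
Proof. by apply: (big_morph (pr i)); [exact: prD|exact: pr0]. Qed.

Lemma pr_gr d x i : gr d x -> pr i x = if i == d then x else 0.
Proof.
move=> gx; rewrite (@prE x d.+1 (fun j => if j == d then x else 0)).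
- by case: eqP => [->|]; rewrite ?ltnSn //; case: ifP.
- by move=> j; case: eqP => [-> //|_]; exact: (submod0 (gr_submod j)).
- rewrite big_ord_recr /= eqxx big1 ?add0r // => j _.
  by rewrite ltn_eqF.
Qed.

Lemma prM d a n y : gr d a -> pr n (a * y) = if (d <= n)%N then a * pr (n - d) y else 0.
Proof.
move=> ga; have [N hN] := pr_sum y.
rewrite {1}(hN (maxn N n.+1)) ?leq_maxl // mulr_sumr pr_bigsum.
rewrite (eq_bigr (fun i : 'I_ _ => if (d + i == n)%N then a * pr i y else 0)); last first.
  move=> i _; rewrite (pr_gr _ (grM ga (gr_pr i y))).
  by rewrite eq_sym.
case: ifP => dn; last first.
  by rewrite big1 // => i _; case: eqP => // e; exfalso; lia.
have h : (n - d < maxn N n.+1)%N by lia.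
rewrite (bigD1 (Ordinal h)) //= subnKC // eqxx big1 ?addr0 // => i ni.
case: eqP => // e; exfalso; move/eqP: ni; apply; apply: val_inj => /=; lia.
Qed.

Definition homogeneous (J : set R) := is_ideal J /\ forall i x, J x -> J (pr i x).

Lemma homogeneous_idealP J : homogeneous_ideal gr J -> homogeneous J.
Proof.
move=> [hJ h]; split=> // i x Jx; have [n hn] := pr_sum x.
apply: (h (maxn n i.+1) (fun i => pr i x)) => //.
- by move=> j; exact: gr_pr.
- by rewrite -hn ?leq_maxl.
- by rewrite leq_maxr.
Qed.

Lemma ideal_submod (J : set R) : is_ideal J -> is_submodule J.
Proof.
move=> hJ; apply/submoduleP; split; first exact: ideal0.
move=> a u v Ju Jv; rewrite -mulr_algl; apply: (idealD hJ) => //.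
exact: ideal_mulr.
Qed.

Lemma mulset_submod (a : R) S : is_submodule S -> is_submodule ( *%R a @` S).
Proof.
move=> hS; apply/submoduleP; split.
  by exists 0; [exact: submod0|rewrite mulr0].
move=> c _ _ [u Su <-] [v Sv <-]; exists (c *: u + v); last first.
  by rewrite mulrDr scalerAr.
by apply: submodD => //; exact: submodZ.
Qed.

Lemma flen_mulset (a : R) (P N : set R) n :
    is_submodule P -> is_submodule N -> N `<=` P ->
    (forall u, P u -> a * u = 0 -> N u) ->
  flen ( *%R a @` P) ( *%R a @` N) n <-> flen P N n.
Proof.
move=> hP hN NP hker; apply: flen_image => //.
- by move=> u v; rewrite mulrBr.
- by move=> S hS _; exact: mulset_submod.
- move=> S hS; apply/submoduleP; split.
    by split; [exact: submod0|rewrite /= mulr0; exact: submod0].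
  move=> c u v [Pu Su] [Pv Sv]; split.
    by apply: submodD => //; exact: submodZ.
  rewrite /= mulrDr -scalerAr; apply: submodD => //; exact: submodZ.
Qed.

(* Compare the top components outside P of the two factors. *)
Lemma homogeneous_prime (P : set R) : homogeneous P -> ~ P 1 ->
    (forall i j a b, gr i a -> gr j b -> P (a * b) -> P a \/ P b) ->
  is_prime_ideal P.
Proof.
move=> [hP homP] nP1 prim; split.
  split; rewrite ?inE; [exact: ideal0|by apply/negP; rewrite inE|].
  by move=> a u v; rewrite !inE => Pu Pv; apply: idealD => //; exact: ideal_mulr.
move=> u v; rewrite !inE => Puv; apply/orP; rewrite !inE; apply: contrapT => nuv.
have top x : ~ P x -> exists i, ~ P (pr i x) /\ forall j, (i < j)%N -> P (pr j x).
  move=> nPx; have [n hn] := pr_sum x.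
  have ub i : `[< ~ P (pr i x) >] -> (i <= n)%N.
    move=> /asboolP nPi; rewrite leqNgt; apply/negP => ni; apply: nPi.
    have -> : pr i x = 0; last exact: ideal0.
    rewrite (@prE x n (fun i => pr i x)); last 2 first.
    - by move=> j; exact: gr_pr.
    - exact: hn.
    by rewrite ltnNge (ltnW ni).
  have ex : exists i, `[< ~ P (pr i x) >].
    apply: contrapT => h; apply: nPx; rewrite (hn n) //; apply: ideal_sum => // i _.
    by apply: contrapT => nPi; apply: h; exists i; apply/asboolP.
  case: (ex_maxnP ex ub) => i /asboolP nPi hi; exists i; split=> // j ij.
  apply: contrapT => nPj; suff : (j <= i)%N by lia.
  by apply: hi; apply/asboolP.
have [i [nPi hi]] : exists i, ~ P (pr i u) /\ forall j, (i < j)%N -> P (pr j u).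
  by apply: top => Pu; apply: nuv; left.
have [j [nPj hj]] : exists i, ~ P (pr i v) /\ forall j, (i < j)%N -> P (pr j v).
  by apply: top => Pv; apply: nuv; right.
suff : P (pr i u * pr j v).
  by move=> /(prim i j _ _ (gr_pr _ _) (gr_pr _ _))[].
have [n hn] := pr_sum u.
have : P (pr (i + j) (u * v)) by exact: homP.
rewrite {1}(hn (maxn n i.+1)) ?leq_maxl // mulr_suml pr_bigsum.
have hi' : (i < maxn n i.+1)%N by lia.
rewrite (bigD1 (Ordinal hi')) //= (prM _ _ (gr_pr i u)) leq_addr addKn.
set S := \sum_(_ < _ | _) _ => h.
suff PS : P S by rewrite -(addrK S (_ * _)); exact: idealB.
apply: ideal_sum => // l ne; rewrite (prM _ _ (gr_pr l u)); case: ifP => [lij|_]; last exact: ideal0.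
have [il|li|e] := ltngtP i l; first by apply: ideal_mull => //; exact: hi.
  by apply: ideal_mulr => //; apply: hj; lia.
by move/eqP: ne; case; apply: val_inj.
Qed.

End Grading.


(** * Standard graded rings: generation in degree 1 and finite components *)

Section Standard.
Variables (k : fieldType) (R : comAlgType k) (gr : nat -> set R).
Hypothesis stdR : standard_graded gr.

Lemma std_noeth : noetherian_ring R. Proof. by case: stdR. Qed.
Lemma std_grading : is_grading gr. Proof. by case: stdR. Qed.
Local Notation grS := (gr_submod std_grading).
Local Notation pr := (pr std_grading).

Lemma gr0E : gr 0%N = range (fun c : k => c%:A : R).
Proof. by case: stdR. Qed.

Lemma gr01 : gr 0%N 1.
Proof. by rewrite gr0E; exists 1 => //; rewrite scale1r. Qed.

(** R_0 plus the ideal generated by R_1 is a subalgebra containing R_1, hence all of R; so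
    positive-degree elements lie in that ideal, which has finitely many generators in R_1.
    Coefficients are then replaced by their components of degree [m]. *)
Lemma gr_succ_gen : exists s : seq R, [/\ uniq s, [set` s] `<=` gr 1%N &
  forall m z, gr m.+1 z ->
    exists r : R -> R, (forall u, gr m (r u)) /\ z = \sum_(u <- s) u * r u].
Proof.
have [s [s1 es]] := noetherian_gen std_noeth (gr 1%N).
exists (undup s); split; [exact: undup_uniq|by move=> u /=; rewrite mem_undup => /s1|].
move=> m z gz.
have hM := ideal_gen_ideal (gr 1%N).
pose T : set R := sumset (gr 0%N) (ideal_gen (gr 1%N)).
have Tz : T z.
  have : [set: R] z by [].
  have [_ _ _ <-] := stdR; apply; split; last first.
    by move=> u gu; apply: sumset_subr; [exact: grS|exact: sub_ideal_gen].
  have hT : is_submodule T.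
    by apply: submodule_sumset; [exact: grS|exact: ideal_submod].
  split; rewrite ?inE.
  - by apply: sumset_subl; [exact: ideal_submod|exact: gr01].
  - by move=> a u v; rewrite !inE => Tu Tv; apply: submodD => //; exact: submodZ.
  - move=> u v; rewrite !inE => -[a [b [ga Mb ->]]] [c [d [gc Md ->]]].
    exists (a * c), (a * d + b * (c + d)); split.
    + exact: (grM std_grading ga gc).
    + by apply: (idealD hM); [exact: (ideal_mulr _ hM)|exact: (ideal_mull _ hM)].
    + by rewrite mulrDl mulrDr addrA.
have [a [b [ga Mb e]]] := Tz.
rewrite es in Mb; have [r er] := ideal_gen_seqP Mb.
exists (fun u => pr m (r u)); split; first by move=> u; exact: gr_pr.
have : pr m.+1 z = z by rewrite (pr_gr std_grading _ gz) eqxx.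
rewrite {1}e prD (pr_gr std_grading _ ga) /= add0r er pr_bigsum => <-.
rewrite big_seq [RHS]big_seq; apply: eq_bigr => u; rewrite mem_undup => /s1 gu.
by rewrite (prM std_grading _ _ gu) /= subn1.
Qed.

Definition mulsets (s : seq R) (P : set R) : set R :=
  foldr (fun u S => sumset ( *%R u @` P) S) [set 0] s.

Lemma mulsets_submod s P : is_submodule P -> is_submodule (mulsets s P).
Proof.
move=> hP; elim: s => [|u s IH]; first exact: submodule_set0.
by apply: submodule_sumset => //; exact: mulset_submod.
Qed.

Lemma mulsets_sum s (P : set R) (F : R -> R) : (forall u, P (F u)) ->
  mulsets s P (\sum_(u <- s) u * F u).
Proof.
move=> PF; elim: s => [|u s IH]; first by rewrite big_nil.
by rewrite big_cons; exists (u * F u), (\sum_(u <- s) u * F u); split=> //; exists (F u).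
Qed.

(** Rank-nullity for multiplication by [a] on [P]. *)
Lemma len_mulset (a : R) (P : set R) : is_submodule P -> flen_fin P ->
  flen_fin ( *%R a @` P) /\ len P = (len ( *%R a @` P) + len (P `&` ann a))%N.
Proof.
move=> hP fP.
have hN : is_submodule (P `&` ann a).
  exact: submoduleI hP (ideal_submod (ideal_ann a)).
have [le hl] := flen_lenB hP hN (@subIsetl _ _ _) fP.
have e0 : *%R a @` (P `&` ann a) = [set 0].
  apply/seteqP; split; first by move=> _ [u [_ ua] <-]; rewrite mulrC.
  by move=> _ ->; exists 0; [exact: submod0|rewrite mulr0].
have : flen ( *%R a @` P) [set 0] (len P - len (P `&` ann a)).
  rewrite -e0; apply/(flen_mulset _ hP hN (@subIsetl _ _ _)) => //.
  by move=> u Pu au0; split=> //; rewrite /ann /= mulrC.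
by move=> h; split; [eexists; exact: h|rewrite (len_flen h) subnK].
Qed.

Lemma len_mulsets (P : set R) s (N : nat) : is_submodule P -> flen_fin P ->
    (forall u, u \in s -> len ( *%R u @` P) <= N)%N ->
  flen_fin (mulsets s P) /\ (len (mulsets s P) <= N * size s)%N.
Proof.
move=> hP fP; elim: s => [_|u s IH h].
  by rewrite /= len_set0; split=> //; exists 0%N; exact: flen_set0.
have [|fs ls] := IH; first by move=> v vs; apply: h; rewrite inE vs orbT.
have [fu _] := len_mulset u hP fP.
have hu := mulset_submod u hP; have hs := mulsets_submod s hP.
split; first exact: flen_fin_sumset.
rewrite /= len_sumset // mulnS addnC; apply: leq_add => //.
by apply: leq_trans (leq_subr _ _) _; apply: h; exact: mem_head.
Qed.

Lemma flen_gr0 : exists2 n, flen (gr 0%N) [set 0] n & (n <= 1)%N.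
Proof.
have gr0S S : is_submodule S -> S 1 -> gr 0%N `<=` S.
  by move=> hS S1; rewrite gr0E => _ [c _ <-]; exact: submodZ.
have n1 S : is_submodule S -> S `<=` gr 0%N -> ~ S 1 -> S `<=` [set 0].
  move=> hS Sg nS1 x Sx; have := Sg _ Sx; rewrite gr0E => -[c _ e].
  apply: contrapT => nx; apply: nS1; have c0 : c != 0.
    by apply/eqP => c0; apply: nx; rewrite -e c0 scale0r.
  by rewrite -[1]scale1r -(mulVf c0) -scalerA; apply: submodZ => //; rewrite e.
have Q0 : between [set 0] (gr 0%N) [set 0].
  by split=> //; [exact: submodule_set0|exact: (sub0_submod (grS 0%N))].
apply: (bounded_height Q0).
apply: (rank_bound (rho := fun S => `[< S 1 >] : nat)); first by move=> S _; case: asboolP.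
move=> S S' [hS S0 Sg] [hS' S0' Sg'] [SS' nSS'].
case: asboolP => [S1|nS1].
  by exfalso; apply: nSS'; apply: (subset_trans Sg'); exact: gr0S.
case: asboolP => [//|nS1']; exfalso; apply: nSS'.
by apply: subset_trans S0; exact: n1.
Qed.

Lemma gr_fin m : flen_fin (gr m).
Proof.
elim: m => [|m IH]; first by have [n hn _] := flen_gr0; exists n.
have [s [_ s1 hs]] := gr_succ_gen.
have [f _] : flen_fin (mulsets s (gr m)) /\ (len (mulsets s (gr m)) <= len (gr m) * size s)%N.
  apply: len_mulsets => //; first exact: grS.
  move=> u _; have [_ ->] := len_mulset u (grS m) IH; exact: leq_addr.
apply: (flen_fin_sub _ (grS _) _ f); first exact/mulsets_submod/grS.
by move=> z /hs[r [gru ->]]; exact: mulsets_sum.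
Qed.

End Standard.

(** * Dimension one *)

Section Dimension.
Variables (RR : realType) (k : fieldType) (R : comAlgType k) (gr : nat -> set R).
Hypothesis stdR : standard_graded gr.
Hypothesis redR : reduced_ring R.
Hypothesis dimR : krull_dim R RR = 1%E.
Local Notation grS := (gr_submod (std_grading stdR)).
Local Notation grading := (std_grading stdR).
Local Notation pr := (pr grading).

Lemma gr_sub_succ (J : set R) n m : is_ideal J ->
  (n <= m)%N -> gr n `<=` J -> gr m `<=` J.
Proof.
move=> hJ; elim: m => [|m IH]; first by case: n.
rewrite leq_eqVlt => /orP[/eqP <- //|]; rewrite ltnS => /IH h nJ z.
have [s [_ s1 hs]] := gr_succ_gen stdR.
move=> /hs[r [gru ->]]; apply: ideal_sum => // u _.
by apply: ideal_mulr => //; exact: h.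
Qed.

Lemma gr_mul_sub n m (J : set R) : is_ideal J ->
  (forall x y, gr n x -> gr m y -> J (x * y)) -> gr (n + m)%N `<=` J.
Proof.
elim: n J => [|n IH] J hJ h z.
  by move=> gz; rewrite -[z]mul1r; apply: h => //; exact: gr01.
have [s [_ s1 hs]] := gr_succ_gen stdR.
move=> /hs[r [gru ->]]; rewrite big_seq; apply: ideal_sum => // u us.
(* The induction passes to the colon ideal of [J] by a factor [u] of degree 1. *)
apply: (IH [set x | J (u * x)]); last exact: gru.
  apply/idealP; split; first by rewrite /= mulr0; exact: ideal0.
  move=> a x y Jx Jy /=; rewrite mulrDr mulrCA; apply: idealD => //.
  exact: ideal_mulr.
move=> x y gx gy /=; rewrite mulrA; apply: h => //.
by have := grM grading (s1 _ us) gx.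
Qed.

Lemma homogeneous_sumset (I J : set R) : homogeneous grading I ->
  homogeneous grading J -> homogeneous grading (sumset I J).
Proof.
move=> [hI pI] [hJ pJ]; split; first exact: ideal_sumset.
move=> i _ [u [v [Iu Jv ->]]]; exists (pr i u), (pr i v); split; [exact: pI|exact: pJ|].
exact: prD.
Qed.

Lemma homogeneous_principal d a : gr d a -> homogeneous grading (principal a).
Proof.
move=> ga; split; first exact: ideal_principal.
move=> i _ [r _ <-]; rewrite (prM _ _ _ ga); case: ifP => _.
  by exists (pr (i - d) r).
exact: (ideal0 (ideal_principal a)).
Qed.

Lemma homogeneous_ann d a : gr d a -> homogeneous grading (ann a).
Proof.
move=> ga; split; first exact: ideal_ann.
move=> i x; rewrite /ann /= => xa.
have := prM grading (d + i)%N x ga; rewrite leq_addr addKn mulrC xa pr0 => ->.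
by rewrite mulrC.
Qed.

(* An ideal maximal among the homogeneous ideals containing no full component
   is prime. *)
Lemma homogeneous_avoid (J : set R) : homogeneous grading J ->
  (exists n, gr n `<=` J) \/
  exists Q, [/\ homogeneous grading Q, is_prime_ideal Q, J `<=` Q & ~ gr 1%N `<=` Q].
Proof.
move=> homJ; have [|nJ] := pselect (exists n, gr n `<=` J); [by left|right].
pose Phi Q := [/\ homogeneous grading Q, J `<=` Q & forall n, ~ gr n `<=` Q].
have PhiJ : Phi J by split=> // n h; apply: nJ; exists n.
have [|Q [[homQ JQ nQ] maxQ]] := noetherian_max (std_noeth stdR) PhiJ.
  by move=> Q [[]].
have [hQ _] := homQ; exists Q; split=> //.
have cover a i : gr i a -> ~ Q a -> exists n, gr n `<=` sumset Q (principal a).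
  move=> ga nQa; apply: contrapT => h; apply: nQa.
  apply: (maxQ (sumset Q (principal a))).
  - split=> [||n hn]; last by apply: h; exists n.
      exact: homogeneous_sumset (homogeneous_principal ga).
    by apply: (subset_trans JQ); apply: ideal_sumset_subl; exact: ideal_principal.
  - by apply: ideal_sumset_subl; exact: ideal_principal.
  - by apply: ideal_sumset_subr => //; exists 1 => //; rewrite mulr1.
apply: (homogeneous_prime homQ) => [Q1|i j a b ga gb Qab].
  by apply: (nQ 0%N) => x _; rewrite -[x]mulr1; exact: ideal_mulr.
have [|nQa] := pselect (Q a); [by left|].
have [|nQb] := pselect (Q b); [by right|].
have [n hn] := cover _ _ ga nQa; have [m hm] := cover _ _ gb nQb.
(* R_(n+m) would lie in (Q + (a))(Q + (b)), which is inside Q because Q contains ab. *)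
exfalso; apply: (nQ (n + m)%N); apply: gr_mul_sub => // x y /hn + /hm.
move=> [u [_ [Qu [r _ <-] ->]]] [v [_ [Qv [s _ <-] ->]]].
rewrite mulrDl; apply: idealD => //; first exact: ideal_mull.
rewrite mulrDr; apply: idealD => //; first exact: ideal_mulr.
by rewrite mulrACA; exact: ideal_mull.
Qed.

Lemma prime_chain (P Q M : set R) : is_prime_ideal P -> is_prime_ideal Q ->
  is_prime_ideal M -> P `<` Q -> Q `<` M -> False.
Proof.
move=> hP hQ hM PQ QM.
have : ((2%:R)%:E <= krull_dim R RR)%E.
  apply: ereal_sup_ubound; exists 2%N => //.
  exists (fun i => if i == 0%N then P else if i == 1%N then Q else M).
  by split=> [[|[|[|]]]|[|[|]]].
by rewrite dimR lee_fin (ler_nat _ 2 1).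
Qed.

Definition irrelevant : set R := [set x | pr 0 x = 0].

Lemma irrelevant_prime : is_prime_ideal irrelevant.
Proof.
apply: (homogeneous_prime (grading := grading)).
- split.
    apply/idealP; split; first exact: pr0.
    move=> a u v /= u0 v0; rewrite /irrelevant /= prD v0 addr0.
    have [n /(_ n (leqnn n)) ->] := pr_sum grading a.
    rewrite mulr_suml pr_bigsum big1 // => i _; rewrite (prM _ _ _ (gr_pr grading i a)).
    by case: ifP => // /[!leqn0] /eqP ->; rewrite u0 mulr0.
  move=> i x; rewrite /irrelevant /= => x0; rewrite (pr_gr _ _ (gr_pr _ i x)).
  by case: eqP => // <-.
- by rewrite /irrelevant /= (pr_gr grading _ (gr01 stdR)) /=; apply/eqP; exact: oner_neq0.
- move=> i j a b ga gb; rewrite /irrelevant /= (prM _ _ _ ga).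
  rewrite (pr_gr _ _ ga); case: i ga => [|i] ga; last by left.
  rewrite leqnn subn0 (pr_gr _ _ gb); case: j gb => [|j] gb; last by right.
  rewrite /=; move: ga gb; rewrite (gr0E stdR) => -[c _ <-] [d _ <-].
  rewrite mulr_algl; have [->|c0] := eqVneq c 0; first by left; rewrite scale0r.
  by move=> e; right; rewrite -[LHS](scalerK c0) e scaler0.
Qed.

(* P < Q < irrelevant would be a chain of primes of length 2. *)
Lemma prime_principal_cofinite (P : set R) u : homogeneous grading P ->
    is_prime_ideal P -> gr 1%N u -> ~ P u ->
  exists n, gr n `<=` sumset P (principal u).
Proof.
move=> homP primeP gu nPu.
have [|//|[Q [homQ primeQ JQ nQ]]] := @homogeneous_avoid (sumset P (principal u)).
  exact: homogeneous_sumset (homogeneous_principal gu).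
have [hQ pQ] := homQ.
case: (prime_chain primeP primeQ irrelevant_prime).
- split; first by apply: subset_trans JQ; apply: ideal_sumset_subl; exact: ideal_principal.
  move=> QP; apply/nPu/QP/JQ; apply: ideal_sumset_subr; first by case: homP.
  by exists 1; rewrite ?mulr1.
- split=> [x /(pQ 0%N)|h]; last first.
    apply: nQ => x gx; apply: h.
    by rewrite /irrelevant /= (pr_gr _ _ gx).
  (* A nonzero component of degree 0 is a unit, so the proper homogeneous ideal [Q] contains
     none. *)
  have := gr_pr grading 0 x; rewrite (gr0E stdR) => -[c _ e]; rewrite -e => Qc.
  have [c0|c0] := eqVneq c 0; first by rewrite /irrelevant /= -e c0 scale0r.
  case: primeQ => -[_ /negP nQ1 _] _; exfalso; apply: nQ1; rewrite inE.
  by rewrite -[1]scale1r -(mulVf c0) -scalerA; apply: submodZ => //; exact: ideal_submod.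
Qed.

(* Maximality of ann b among the annihilators of the nonzero homogeneous
   multiples of b makes it prime. *)
Definition good d b := [/\ gr d b, (0 < d)%N, b <> 0 &
  forall j s, gr j s -> s * b <> 0 -> ann (s * b) `<=` ann b].

Lemma good_prime d b : good d b -> is_prime_ideal (ann b).
Proof.
move=> [gb _ b0 hb]; apply: (homogeneous_prime (homogeneous_ann gb)).
  by rewrite /ann /= mul1r.
move=> i j x y gx gy; rewrite /ann /= => xyb.
have [|nyb] := pselect (y * b = 0); [by right|left].
by apply: (hb _ _ gy nyb); rewrite /ann /= mulrA.
Qed.

Lemma good_multiple d r : gr d r -> (0 < d)%N -> r <> 0 ->
  exists j s, gr j s /\ good (j + d) (s * r).
Proof.
move=> gr_r d0 r0.
pose Phi J := exists j s, [/\ gr j s, s * r <> 0 & J = ann (s * r)].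
have [||J [[j [s [gs sr0 ->]]] maxJ]] := @noetherian_max _ (std_noeth stdR) Phi (ann (1 * r)).
- by exists 0%N, 1; split; [exact: gr01|rewrite mul1r|].
- by move=> J [j [s [_ _ ->]]]; exact: ideal_ann.
exists j, s; split=> //; split=> //; [exact: (grM grading)|by rewrite addn_gt0 d0 orbT|].
move=> i t gt tsr0; apply: maxJ.
  by exists (i + j)%N, (t * s); split; [exact: (grM grading)|rewrite -mulrA|rewrite mulrA].
by move=> x; rewrite /ann /= => e; rewrite mulrCA e mulr0.
Qed.

(** Take an orthogonal family whose generated ideal is maximal. If a nonzero [r] were killed by all
    of it, a good multiple of [r] could be added: it is outside the ideal, since an element of the
    ideal that kills the generators squares to zero. *)
Lemma good_family : exists l : seq R,
  [/\ uniq l, forall b, b \in l -> exists d, good d b,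
     forall b b', b \in l -> b' \in l -> b <> b' -> b * b' = 0
   & forall d r, (0 < d)%N -> gr d r -> (forall b, b \in l -> r * b = 0) -> r = 0].
Proof.
pose Psi l := [/\ uniq l, forall b, b \in l -> exists d, good d b
  & forall b b' : R, b \in l -> b' \in l -> b <> b' -> b * b' = 0].
pose Phi J := exists l : seq R, Psi l /\ J = ideal_gen [set` l].
have [||J [[l [Pl ->]] maxJ]] := @noetherian_max _ (std_noeth stdR) Phi (ideal_gen [set` [::]]).
- by exists [::].
- by move=> J [l [_ ->]]; exact: ideal_gen_ideal.
have [ul gl ol] := Pl; exists l; split=> // d r d0 gr_r rl; apply: contrapT => r0.
have [j [s [gs gd]]] := good_multiple gr_r d0 r0.
have bl b : b \in l -> s * r * b = 0 by move=> /rl e; rewrite -mulrA e mulr0.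
have nl : ~ ideal_gen [set` l] (s * r).
  move=> h; have [_ _ + _] := gd; apply; apply: (redR (n := 2)).
  rewrite expr2; apply: (ideal_gen_min (J := [set x | s * r * x = 0])) h => //.
  apply/idealP; split; first by rewrite /= mulr0.
  by move=> a u v /= hu hv; rewrite mulrDr mulrCA hu hv mulr0 addr0.
apply: nl; apply: (maxJ (ideal_gen [set` s * r :: l])); last 2 first.
- apply: ideal_gen_min; first exact: ideal_gen_ideal.
  by move=> x xl; apply: sub_ideal_gen; rewrite /= inE xl orbT.
- by apply: sub_ideal_gen; rewrite /= mem_head.
exists (s * r :: l); split=> //; split.
- rewrite /= ul andbT; apply/negP => h; have [_ _ + _] := gd; apply.
  by apply: (redR (n := 2)); rewrite expr2; exact: bl.
- by move=> b; rewrite inE => /orP[/eqP ->|/gl//]; exists (j + d)%N.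
- move=> b b'; rewrite !inE => /orP[/eqP ->|bin] /orP[/eqP ->|bin'] //.
  + by move=> _; exact: bl.
  + by move=> _; rewrite mulrC; exact: bl.
  + exact: ol.
Qed.

(** As [b] has positive degree and [b * b] is nonzero, expanding one factor over the degree 1
    generators yields a [u] with [u * b] nonzero. Maximality of [ann b] extends this to the powers
    of [u]. *)
Lemma good_unit d b : good d b -> exists u, [/\ gr 1%N u, u * b <> 0 &
  forall j, u ^+ j * b <> 0].
Proof.
move=> [gb d0 b0 hb]; have [s [_ s1 hs]] := gr_succ_gen stdR.
have [u us ub] : exists2 u, u \in s & u * b <> 0.
  apply: contrapT => h; apply: b0; apply: (redR (n := 2)); rewrite expr2.
  case: d gb d0 hb => // d gb _ _; have [r [_ {1}->]] := hs _ _ gb.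
  rewrite mulr_suml big_seq big1 // => u us; rewrite mulrAC.
  have [->|ne] := eqVneq (u * b) 0; first by rewrite mul0r.
  by case: h; exists u => //; apply/eqP.
have gu := s1 _ us; exists u; split=> //.
elim=> [|j IH]; first by rewrite mul1r.
move=> e; apply: ub.
have guj : gr j (u ^+ j).
  by elim: j {IH e} => [|j IH]; [exact: gr01|rewrite exprS; exact: (grM grading gu IH)].
by apply: (hb _ _ guj IH); rewrite /ann /= mulrA -exprS.
Qed.

Lemma gr_exp d a n : gr d a -> gr (d * n)%N (a ^+ n).
Proof.
move=> ga; elim: n => [|n IH]; first by rewrite muln0; exact: gr01.
by rewrite mulnS exprS; exact: (grM grading).
Qed.

(** Modulo the prime [ann b], all large components are multiples of [u]. Hence u b R_n contains b
    R_(n+1) from degree [n0] on, and the lengths no longer grow. *)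
Lemma good_bounded d b : good d b ->
  exists B, forall n, (len ( *%R b @` gr n) <= B)%N.
Proof.
move=> gd; have [gb d0 b0 hb] := gd.
have [u [gu ub _]] := good_unit gd.
have [n0 hn0] := prime_principal_cofinite (homogeneous_ann gb) (good_prime gd) gu ub.
have hJ : is_ideal (sumset (ann b) (principal u)).
  by apply: ideal_sumset; [exact: ideal_ann|exact: ideal_principal].
have fin n : flen_fin ( *%R b @` gr n).
  by have [] := len_mulset b (grS n) (gr_fin stdR n).
have step n : (n0 <= n)%N -> (len ( *%R b @` gr n.+1) <= len ( *%R b @` gr n))%N.
  move=> nn; apply: (@leq_trans (len ( *%R u @` ( *%R b @` gr n)))); last first.
    by have [_ ->] := len_mulset u (mulset_submod b (grS n)) (fin n); exact: leq_addr.
  apply: len_le.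
  - by do 2!apply: mulset_submod; exact: grS.
  - by apply: mulset_submod; exact: grS.
  - move=> _ [r gr_r <-]; have [x [_ [xb [t _ <-] e]]] := gr_sub_succ hJ (leqW nn) hn0 gr_r.
    exists (b * pr n t); first by exists (pr n t) => //; exact: gr_pr.
    have {1}-> : r = pr n.+1 x + u * pr n t.
      have : pr n.+1 r = r by rewrite (pr_gr _ _ gr_r) eqxx.
      by rewrite {1}e prD (prM _ _ _ gu) /= subn1 => <-.
    have [_ homb] := homogeneous_ann gb.
    rewrite mulrDr; have := homb n.+1 _ xb; rewrite /ann /= mulrC => ->.
    by rewrite add0r mulrCA.
  - by have [] := len_mulset u (mulset_submod b (grS n)) (fin n).
exists (\sum_(i < n0.+1) len ( *%R b @` gr i)) => n.
have bi i : (i <= n0)%N -> (len ( *%R b @` gr i) <= \sum_(i < n0.+1) len ( *%R b @` gr i))%N.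
  move=> h; rewrite -ltnS in h; by rewrite (bigD1 (Ordinal h)) //= leq_addr.
elim: n => [|n IH]; first exact: bi.
have [nn|nn] := leqP n0 n; first exact: leq_trans (step _ nn) IH.
exact: bi.
Qed.
End Dimension.

(** * Stability in large degrees *)

Section Stability.
Variables (RR : realType) (k : fieldType) (R : comAlgType k) (gr : nat -> set R).
Hypothesis stdR : standard_graded gr.
Hypothesis redR : reduced_ring R.
Hypothesis dimR : krull_dim R RR = 1%E.
Local Notation grS := (gr_submod (std_grading stdR)).
Local Notation grading := (std_grading stdR).
Local Notation pr := (pr grading).
Local Notation grF := (gr_fin stdR).

(** Only homogeneous elements of positive degree are tested: this is the range in which
    [good_family] detects zero. *)
Definition nzd (y : R) := forall d r, (0 < d)%N -> gr d r -> y * r = 0 -> r = 0.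

Lemma reduced_sqr (x : R) : x * x = 0 -> x = 0.
Proof. by rewrite -expr2; exact: redR. Qed.

Lemma nzd_exists : exists c B, forall N, (c <= N)%N ->
  exists y, [/\ gr N y, nzd y & forall n, (len ( *%R y @` gr n) <= B)%N].
Proof.
have [l [ul gl ol nl]] := good_family stdR redR.
have /choice[f hf] : forall b, exists t : nat * R * nat, b \in l ->
    [/\ good gr t.1.1 b, gr 1%N t.1.2, forall j, t.1.2 ^+ j * b <> 0
      & forall n, (len ( *%R b @` gr n) <= t.2)%N].
  move=> b; have [bl|] := boolP (b \in l); last by exists (0%N, 0, 0%N).
  have [d gd] := gl b bl; have [u [gu _ ub]] := good_unit stdR redR gd.
  by have [B hB] := good_bounded stdR redR dimR gd; exists (d, u, B).
pose deg b := (f b).1.1; pose u b := (f b).1.2.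
pose B := (\sum_(b <- l) (f b).2)%N.
have sum_ge (F : R -> nat) b : b \in l -> (F b <= \sum_(b <- l) F b)%N.
  by move=> bl; rewrite (bigD1_seq b) //= leq_addr.
(* The threshold makes every exponent [N - deg b] a true difference. The bound holds because y R_n
   lies in the sum of the spaces w_b b R_n, each of length at most [B]. *)
exists (\sum_(b <- l) deg b)%N, (B * size l)%N => N hN.
pose w b := u b ^+ (N - deg b); pose y := \sum_(b <- l) w b * b.
have gw b : b \in l -> gr (N - deg b)%N (w b).
  by move=> /hf[_ gu _ _]; have := gr_exp stdR (N - deg b) gu; rewrite mul1n.
exists y; split.
- rewrite /y big_seq; apply: (submod_sum _ (grS N)) => b bl.
  have [[gb _ _ _] _ _ _] := hf b bl.
  have := grM grading (gw b bl) gb; rewrite subnK //.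
  by apply: leq_trans hN; exact: sum_ge.
- move=> d r d0 gr_r yr; apply: (nl d) => // b bl.
  have [[gb db b0 hb] gu ub _] := hf b bl.
  apply: (hb _ _ (gw b bl)); first exact: ub.
  (* Orthogonality gives y b = w_b b^2, so the square of r w_b b is r w_b (y b) r = 0. *)
  rewrite /ann /=; apply: reduced_sqr.
  have yb : y * b = w b * b * b.
    rewrite /y mulr_suml (bigD1_seq b) //= big_seq_cond big1 ?addr0 // => b' /andP[bl' ne].
    by rewrite -mulrA (ol b' b) ?mulr0 //; move/eqP: ne.
  rewrite (_ : _ * _ = r * w b * ((w b * b * b) * r)); last by ring.
  by rewrite -yb (mulrAC y) yr mul0r mulr0.
- move=> n; set s := [seq w b * b | b <- l].
  have hS := mulsets_submod s (grS n).
  have [|fs ls] := @len_mulsets _ _ (gr n) s B (grS n) (grF n).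
    move=> _ /mapP[b bl ->]; have [_ _ _ hB] := hf b bl.
    have -> : *%R (w b * b) @` gr n = *%R (w b) @` ( *%R b @` gr n).
      by rewrite image_comp; apply: eq_imagel => x _; rewrite /= mulrA.
    have [fb _] := len_mulset b (grS n) (grF n).
    apply: (@leq_trans (len ( *%R b @` gr n))).
      by have [_ ->] := len_mulset (w b) (mulset_submod b (grS n)) fb; exact: leq_addr.
    by apply: (leq_trans (hB n)); exact: (sum_ge (fun b => (f b).2)).
  rewrite size_map in ls; apply: leq_trans ls; apply: len_le => //.
    exact: (mulset_submod y (grS n)).
  move=> _ [r gr_r <-]; have := mulsets_sum s (F := fun=> r) (fun=> gr_r).
  by rewrite big_map /y mulr_suml.
Qed.

Lemma flen_fin_I m (J : set R) : is_submodule J -> flen_fin (gr m `&` J).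
Proof.
move=> hJ; apply: (flen_fin_sub (grS m) _ _ (grF m)); [exact: (submoduleI (grS m))|exact: subIsetl].
Qed.

Lemma len_mulset_inj (y : R) (P : set R) : is_submodule P -> flen_fin P ->
  (forall r, P r -> y * r = 0 -> r = 0) -> len ( *%R y @` P) = len P.
Proof.
move=> hP fP hy; have [_ ->] := len_mulset y hP fP.
suff -> : P `&` ann y = [set 0] by rewrite len_set0 addn0.
apply/seteqP; split=> [r [Pr ry]|_ ->]; first by apply: hy; rewrite // mulrC.
by split; [exact: submod0|rewrite /ann /= mul0r].
Qed.

Definition stable c e := [/\ (0 < c)%N, forall n, (c <= n)%N -> len (gr n) = e
  & forall N, (c <= N)%N -> exists y, gr N y /\ nzd y].

(** Multiplication by a nonzerodivisor embeds R_n, which bounds its length for positive [n]. The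
    largest such length, attained at [n0], persists in all degrees reached from [n0] by a
    nonzerodivisor. *)
Lemma stable_exists : exists c e, stable c e /\ exists B, forall n, (len (gr n) <= B)%N.
Proof.
have [c [B hy]] := nzd_exists.
have bound n : (0 < n)%N -> (len (gr n) <= B)%N.
  move=> n0; have [y [gy ny hB]] := hy c (leqnn c).
  rewrite -(len_mulset_inj (grS n) (grF n) (y := y)) // => r gr_r; exact: ny gr_r.
have ex : exists e, `[< exists2 n, (0 < n)%N & len (gr n) = e >].
  by exists (len (gr 1%N)); apply/asboolP; exists 1%N.
have ub e : `[< exists2 n, (0 < n)%N & len (gr n) = e >] -> (e <= B)%N.
  by move=> /asboolP[n n0 <-]; exact: bound.
case: (ex_maxnP ex ub) => e /asboolP[n0 n00 en0] he.
(* From this threshold on, [n - n0] is a degree in which nonzerodivisors exist. Degree 0 needs its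
   own bound, since [nzd] does not see it. *)
exists (n0 + c)%N, e; split; last first.
  exists (maxn B (len (gr 0%N))) => -[|n]; first by rewrite leq_maxr.
  by apply: (leq_trans (bound n.+1 isT)); rewrite leq_maxl.
split=> [|n hn|N hN]; first by rewrite addn_gt0 n00.
  apply/eqP; rewrite eqn_leq; apply/andP; split.
    by apply: he; apply/asboolP; exists n => //; lia.
  have [|y [gy ny _]] := hy (n - n0)%N; first by lia.
  rewrite -en0 -(len_mulset_inj (grS n0) (grF n0) (y := y)); last first.
    by move=> r; exact: ny.
  apply: (len_le (grS n) (mulset_submod y (grS n0)) _ (grF n)).
  move=> _ [r gr_r <-]; have := grM grading gy gr_r.
  by rewrite subnK //; lia.
by have [|y [gy ny _]] := hy N; [lia|exists y].
Qed.

Variables (c e : nat).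
Hypothesis stab : stable c e.

Lemma stable_gt0 : (0 < c)%N. Proof. by case: stab. Qed.

Lemma mul_nzd_onto n N y : (c <= n)%N -> gr N y -> nzd y ->
  *%R y @` gr n = gr (N + n)%N.
Proof.
move=> cn gy ny; have [c0 he _] := stab; apply: (len_eq (grS _) (mulset_submod y (grS n)) _ (grF _)).
- by move=> _ [r gr_r <-]; exact: (grM grading).
- rewrite (len_mulset_inj (grS n) (grF n)); last by move=> r; apply: ny; exact: leq_trans cn.
  by rewrite !he //; lia.
Qed.

Lemma nzd_stable (J : set R) D : is_ideal J -> (c <= D)%N ->
    (forall n N y, (D <= n)%N -> gr N y -> nzd y ->
      gr (N + n)%N `&` J `<=` *%R y @` (gr n `&` J)) ->
  forall n m, (D <= n)%N -> (D <= m)%N -> len (gr n `&` J) = len (gr m `&` J).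
Proof.
move=> hJ cD onto; have [c0 _ hy] := stab.
suff h n N : (D <= n)%N -> (c <= N)%N -> len (gr n `&` J) = len (gr (N + n)%N `&` J).
  (* Both degrees are compared with [n + m + c], which either reaches by a shift of at least [c]. *)
  move=> n m Dn Dm; rewrite (h n (m + c)%N) ?(h m (n + c)%N) //; last 2 first.
  - exact: leq_addl.
  - exact: leq_addl.
  by congr (len (gr _ `&` J)); lia.
move=> Dn cN; have [y [gy ny]] := hy N cN.
have hJk := ideal_submod hJ.
have -> : gr (N + n)%N `&` J = *%R y @` (gr n `&` J).
  apply/seteqP; split; first exact: onto.
  move=> _ [r [gr_r Jr] <-]; split; first exact: (grM grading).
  exact: ideal_mulr.
rewrite (len_mulset_inj (submoduleI (grS n) hJk) (flen_fin_I _ hJk)) //.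
by move=> r [gr_r _]; apply: ny gr_r; lia.
Qed.

(** [ann a] is saturated: a nonzerodivisor [y] can be cancelled from [y * r * a = 0]. *)
Lemma len_ann_stable d a n m : gr d a -> (c <= n)%N -> (c <= m)%N ->
  len (gr n `&` ann a) = len (gr m `&` ann a).
Proof.
move=> ga; apply: (nzd_stable (ideal_ann a)) => // {}n N y cn gy ny x [].
rewrite -(mul_nzd_onto cn gy ny) => -[r gr_r <-] {x}.
rewrite /ann /= => e0; exists r => //; split=> //; rewrite /ann /=.
apply: (ny _ _ _ (grM grading gr_r ga)); last by rewrite mulrA.
by have := stable_gt0; lia.
Qed.

Lemma ann_exp (a : R) q : (0 < q)%N -> ann (a ^+ q) = ann a.
Proof.
case: q => // q _; apply/seteqP; split=> r; rewrite /ann /= => h.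
  by apply: (redR (n := q.+1)); rewrite exprMn exprS -mulrA mulrCA h mulr0.
by rewrite exprS mulrA h mul0r.
Qed.

(* a and a ^+ q have the same annihilator, hence the images of multiplication by
   them have the same length in large degrees, with a bound independent of q. *)
Lemma mul_exp_stable d (a : R) q n : gr d a -> (0 < q)%N -> (c <= n)%N ->
  *%R a @` gr (n + d * q.-1)%N = *%R (a ^+ q) @` gr n.
Proof.
move=> ga q0 cn; have [_ he _] := stab; symmetry.
have [fa ea] := len_mulset a (grS (n + d * q.-1)%N) (grF _).
have [faq eaq] := len_mulset (a ^+ q) (grS n) (grF n).
apply: (len_eq (mulset_submod a (grS _)) (mulset_submod _ (grS n)) _ fa).
  move=> _ [r gr_r <-]; exists (a ^+ q.-1 * r); last by rewrite mulrA -exprS prednK.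
  by rewrite addnC; apply: (grM grading) => //; exact: gr_exp.
move: ea eaq; rewrite !he ?(leq_trans cn (leq_addr _ _)) // (ann_exp _ q0).
rewrite (len_ann_stable (n := n) (m := (n + d * q.-1)%N) ga) //.
  by move=> -> /eqP; rewrite eqn_add2r => /eqP.
exact: leq_trans cn (leq_addr _ _).
Qed.

Variable I : set R.

(** With [D] the ceiling of x, this is the ideal K of the overview. *)
Definition low D : set R := ideal_gen [set a | exists d, [/\ (d < D)%N, gr d a & I a]].

Lemma low_ideal D : is_ideal (low D).
Proof. exact: ideal_gen_ideal. Qed.

(** The induction proves [P (pr m z)] for every [z] in the ideal, which lets arbitrary cofactors be
    replaced by homogeneous ones. *)
Lemma low_ind D m (P : R -> Prop) :
    P 0 -> (forall u v, P u -> P v -> P (u + v)) ->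
    (forall d a r, (d < D)%N -> (d <= m)%N -> gr d a -> I a -> gr (m - d)%N r -> P (a * r)) ->
  forall z, gr m z -> low D z -> P z.
Proof.
move=> P0 PD PM z gz Lz.
suff : P (pr m z) by rewrite (pr_gr _ _ gz) eqxx.
move: z Lz {gz}; apply: (@ideal_gen_ind _ _ (fun z => P (pr m z))).
- by rewrite pr0.
- by move=> u v Pu Pv; rewrite prD; exact: PD.
- move=> r a [d [dD ga Ia]]; rewrite mulrC (prM _ _ _ ga); case: ifP => // dm.
  exact: (PM d a _ dD dm ga Ia (gr_pr _ _ _)).
Qed.

Lemma low_mem D d a r : (d < D)%N -> gr d a -> I a -> low D (a * r).
Proof.
move=> dD ga Ia; apply: (ideal_mull _ (low_ideal D)); apply: sub_ideal_gen.
by exists d.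
Qed.

(** A generator of degree below [D] leaves a cofactor of degree at least [c], and there
    multiplication by a nonzerodivisor is onto, so it is the cofactor that gets divided. *)
Lemma len_low_stable D n m : (c + D <= n)%N -> (c + D <= m)%N ->
  len (gr n `&` low D) = len (gr m `&` low D).
Proof.
apply: (nzd_stable (low_ideal D) (leq_addr _ _)).
move=> {}n N y cn gy ny z [gz Lz]; move: z gz Lz; apply: low_ind.
- exists 0; last by rewrite mulr0.
  by split; [exact: (submod0 (grS n))|exact: (ideal0 (low_ideal D))].
- move=> _ _ [u [gu Lu] <-] [v [gv Lv] <-]; exists (u + v); last by rewrite mulrDr.
  by split; [exact: (submodD (grS n))|exact: (idealD (low_ideal D))].
- move=> d a r dD dm ga Ia gr_r.
  have cnd : (c <= n - d)%N by lia.
  move: gr_r; have -> : (N + n - d = N + (n - d))%N by lia.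
  rewrite -(mul_nzd_onto cnd gy ny) => -[t gt <-].
  exists (a * t); last by rewrite mulrCA.
  split; last exact: low_mem ga Ia.
  by have := grM grading ga gt; rewrite subnKC //; lia.
Qed.

End Stability.

(** * Frobenius powers *)

Section Frobenius.
Variables (p : nat) (k : fieldType) (R : comAlgType k).
Hypothesis hk : perfect_field p k.

Lemma p_pchar : p \in [pchar R].
Proof. by rewrite pchar_lalg; case: hk. Qed.

Lemma p_gt0 : (0 < p)%N.
Proof. exact/prime_gt0/(pcharf_prime p_pchar). Qed.

Lemma expD_pchar n (x y : R) : (x + y) ^+ (p ^ n) = x ^+ (p ^ n) + y ^+ (p ^ n).
Proof.
elim: n => [|n IH]; first by rewrite !expr1.
rewrite expnSr !exprM IH -!(pFrobenius_autE p_pchar).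
by rewrite rmorphD.
Qed.

Lemma expB_pchar n (x y : R) : (x - y) ^+ (p ^ n) = x ^+ (p ^ n) - y ^+ (p ^ n).
Proof. by rewrite -{2}(subrK y x) (expD_pchar n (x - y) y) addrK. Qed.

Lemma exp0_pchar n : (0 : R) ^+ (p ^ n) = 0.
Proof. by rewrite expr0n expn_eq0 gtn_eqF ?p_gt0. Qed.

Lemma root_pchar n (x : k) : exists y, y ^+ (p ^ n) = x.
Proof.
elim: n x => [|n IH] x; first by exists x; rewrite expr1.
have [_ /(_ x)[y <-]] := hk; have [z <-] := IH y.
by exists z; rewrite expnSr exprM.
Qed.

Definition frob n (x : R) := x ^+ (p ^ n).

Lemma frob_submod n (S : set R) : is_submodule S -> is_submodule (frob n @` S).
Proof.
move=> hS; apply/submoduleP; split.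
  by exists 0; [exact: submod0|exact: exp0_pchar].
move=> a _ _ [u Su <-] [v Sv <-]; have [b <-] := root_pchar n a.
exists (b *: u + v); first by apply: submodD => //; exact: submodZ.
by rewrite /frob expD_pchar exprZn.
Qed.

Lemma frob_preimage_submod n (P S : set R) : is_submodule P -> is_submodule S ->
  is_submodule (P `&` frob n @^-1` S).
Proof.
move=> hP hS; apply/submoduleP; split.
  split; [exact: submod0|rewrite /= /frob exp0_pchar; exact: submod0].
move=> a u v [Pu Su] [Pv Sv]; split; first by apply: submodD => //; exact: submodZ.
by rewrite /= /frob expD_pchar exprZn; apply: submodD => //; exact: submodZ.
Qed.

Hypothesis redR : reduced_ring R.

(** Frobenius is injective since R is reduced. It maps subspaces to subspaces because scalars have
    q-th roots in the perfect field. *)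
Lemma len_frob n (P : set R) : is_submodule P -> flen_fin P ->
  flen_fin (frob n @` P) /\ len (frob n @` P) = len P.
Proof.
move=> hP fP.
have e0 : frob n @` [set 0] = [set 0] by rewrite image_set1 /frob exp0_pchar.
have h : flen (frob n @` P) [set 0] (len P).
  rewrite -e0; apply/(flen_image hP (sub0_submod hP)); last exact: lenP.
  - exact: expB_pchar.
  - by move=> S hS _; exact: frob_submod.
  - by move=> S; exact: frob_preimage_submod.
  - by move=> u _ /redR.
by split; [exists (len P)|exact: len_flen].
Qed.

End Frobenius.

Lemma nondecreasing_bounded_eventually (w : nat -> nat) B :
  (forall n, (w n <= w n.+1)%N) -> (forall n, (w n <= B)%N) ->
  exists N, forall n, (N <= n)%N -> w n = w N.
Proof.
move=> wS wB.
have wmono n m : (n <= m)%N -> (w n <= w m)%N.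
  by elim: m => [|m IH]; [case: n|rewrite leq_eqVlt ltnS => /orP[/eqP ->//|/IH h]; exact: leq_trans (wS m)].
have ex : exists e, `[< exists n, w n = e >] by exists (w 0%N); apply/asboolP; exists 0%N.
have ub e : `[< exists n, w n = e >] -> (e <= B)%N by move=> /asboolP[n <-].
case: (ex_maxnP ex ub) => e /asboolP[N <-] he; exists N => n Nn.
by apply/eqP; rewrite eqn_leq (wmono N n Nn) andbT; apply: he; apply/asboolP; exists n.
Qed.

(** * Graded components of Frobenius powers *)

Section Density.
Variables (p : nat) (k : fieldType) (R : comAlgType k).
Variables (gr : nat -> set R) (I : set R).
Hypothesis hk : perfect_field p k.
Hypothesis stdR : standard_graded gr.
Hypothesis redR : reduced_ring R.
Local Notation grS := (gr_submod (std_grading stdR)).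
Local Notation grading := (std_grading stdR).
Local Notation pr := (pr grading).
Local Notation grF := (gr_fin stdR).
Variables c e : nat.
Hypothesis stab : stable gr c e.
Hypothesis homI : homogeneous grading I.

Let hI : is_ideal I. Proof. by case: homI. Qed.
Let pgt0 := p_gt0 R hk.
Local Notation J n := (frobenius_power I (p ^ n)).
Local Notation low := (low gr I).

Lemma frobenius_power_ideal q : is_ideal (frobenius_power I q).
Proof. exact: ideal_gen_ideal. Qed.

Let hJ n : is_ideal (J n) := frobenius_power_ideal (p ^ n).

Lemma frobenius_power_mem a q r : I a -> frobenius_power I q (a ^+ q * r).
Proof.
move=> Ia; apply: (ideal_mull _ (frobenius_power_ideal q)).
by apply: sub_ideal_gen; exists a.
Qed.

(** Additivity of Frobenius splits a^q into the q-th powers of the components of [a], each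
    homogeneous; hence Frobenius powers of [I] are homogeneous. *)
Lemma pr_frob_mul n m a r :
  exists d : nat, pr m (a ^+ (p ^ n) * r) = \sum_(i < d)
    if (i * p ^ n <= m)%N then pr i a ^+ (p ^ n) * pr (m - i * p ^ n) r else 0.
Proof.
have [d /(_ d (leqnn d)) ea] := pr_sum grading a; exists d.
have -> : a ^+ (p ^ n) = \sum_(i < d) pr i a ^+ (p ^ n).
  rewrite {1}ea (big_morph (fun x => x ^+ (p ^ n)) (expD_pchar hk n) (exp0_pchar R hk n)).
  by [].
rewrite mulr_suml pr_bigsum; apply: eq_bigr => i _.
by rewrite (prM _ _ _ (gr_exp stdR (p ^ n) (gr_pr grading i a))).
Qed.

Lemma frobenius_power_homogeneous n : homogeneous grading (J n).
Proof.
split=> // i x; apply: (@ideal_gen_ind _ _ (fun x => J n (pr i x))).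
- by rewrite pr0; exact: (ideal0 (hJ n)).
- by move=> u v hu hv; rewrite prD; exact: (idealD (hJ n)).
- move=> r _ [a Ia <-]; rewrite mulrC; have [d ->] := pr_frob_mul n i a r.
  apply: (ideal_sum _ (hJ n)) => j _; case: ifP => _; last exact: (ideal0 (hJ n)).
  by apply: frobenius_power_mem; case: homI => _; apply.
Qed.

Lemma frobenius_power_ind n m (P : R -> Prop) :
    P 0 -> (forall u v, P u -> P v -> P (u + v)) ->
    (forall d a r, (d * p ^ n <= m)%N -> gr d a -> I a -> gr (m - d * p ^ n)%N r ->
      P (a ^+ (p ^ n) * r)) ->
  forall z, gr m z -> J n z -> P z.
Proof.
move=> P0 PD PM z gz Jz.
suff : P (pr m z) by rewrite (pr_gr _ _ gz) eqxx.
move: z Jz {gz}; apply: (@ideal_gen_ind _ _ (fun z => P (pr m z))).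
- by rewrite pr0.
- by move=> u v Pu Pv; rewrite prD; exact: PD.
- move=> r _ [a Ia <-]; rewrite mulrC; have [d ->] := pr_frob_mul n m a r.
  elim/big_ind: _ => // i _; case: ifP => // im.
  by apply: (PM i) => //; [exact: gr_pr|case: homI => _; apply|exact: gr_pr].
Qed.

(** The margin [c] allows [mul_exp_stable] to rewrite a R_(m-d) as a^q R_(m-dq) for a generator [a]
    of degree [d]. *)
Lemma low_sub_frobenius n m D :
  (forall d, (d < D)%N -> (d * p ^ n + c <= m)%N) -> gr m `&` low D `<=` J n.
Proof.
move=> hm z [gz Lz]; move: z gz Lz; apply: (low_ind stdR).
- exact: (ideal0 (hJ n)).
- by move=> u v; exact: (idealD (hJ n)).
- move=> d a r dD dm ga Ia gr_r; have hd := hm _ dD.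
  have q0 : (0 < p ^ n)%N by rewrite expn_gt0 pgt0.
  have : ( *%R a @` gr (m - d * p ^ n + d * (p ^ n).-1)%N) (a * r).
    exists r => //; rewrite (_ : (_ + _ = m - d)%N) //.
    by move: q0 hd; case: (p ^ n)%N => // q _; rewrite mulnS /=; lia.
  rewrite (mul_exp_stable stdR redR stab ga q0); last by lia.
  by move=> [t _ <-]; exact: frobenius_power_mem.
Qed.

(* V is the part of I whose q-th powers land exactly in degree m; perfectness
   absorbs the coefficients from R_0 into the q-th powers. *)
Lemma frobenius_component n m D (V : set R) :
    (forall d, (d < D)%N -> (d * p ^ n + c <= m)%N) ->
    (m = (D * p ^ n)%N /\ V = gr D `&` I \/ (m < D * p ^ n)%N /\ V = [set 0]) ->
  gr m `&` J n = sumset (frob p n @` V) (gr m `&` low D).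
Proof.
move=> hm hV; have q0 : (0 < p ^ n)%N by rewrite expn_gt0 pgt0.
have hLD := low_ideal gr I D.
have hL : is_submodule (gr m `&` low D) by apply: (submoduleI (grS m)); exact: ideal_submod.
have hVs : is_submodule V.
  case: hV => -[_ ->]; last exact: submodule_set0.
  by apply: (submoduleI (grS D)); exact: ideal_submod.
have hFV := frob_submod hk n hVs.
have hJm : is_submodule (gr m `&` J n) by apply: (submoduleI (grS m)); exact: ideal_submod.
apply/seteqP; split; last first.
  apply: sumset_sub => //; last first.
    by move=> x [gx Lx]; split=> //; apply: (low_sub_frobenius hm).
  move=> _ [a Va <-]; case: hV => -[em eV]; rewrite eV in Va.
    case: Va => ga Ia; split; first by rewrite em; exact: gr_exp.
    by rewrite -[frob _ _ _]mulr1; exact: frobenius_power_mem.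
  by rewrite Va /frob (exp0_pchar R hk); exact: submod0.
move=> z [gz Jz]; move: z gz Jz; apply: frobenius_power_ind.
- exact: (submod0 (submodule_sumset hFV hL)).
- by move=> u v; exact: (submodD (submodule_sumset hFV hL)).
- move=> d a r dm ga Ia gr_r.
  have gm : gr m (a ^+ (p ^ n) * r).
    by have := grM grading (gr_exp stdR (p ^ n) ga) gr_r; rewrite subnKC.
  have [dD|Dd] := ltnP d D.
    apply: (sumset_subr hFV); split=> //.
    have -> : a ^+ (p ^ n) * r = a * (a ^+ (p ^ n).-1 * r) by rewrite mulrA -exprS prednK.
    exact: low_mem dD ga Ia.
  have le := leq_mul Dd (leqnn (p ^ n)).
  case: hV => -[em eV]; last by exfalso; lia.
  have eD : d = D.
    by apply/eqP; rewrite eqn_leq Dd andbT -(leq_pmul2r q0) -em.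
  apply: (sumset_subl hL); move: gr_r; rewrite eD em subnn (gr0E stdR) => -[b _ <-].
  have [b' <-] := root_pchar hk n b; exists (b' *: a).
    by rewrite eV; split; [apply: (submodZ _ (grS D)); rewrite -eD|apply: (submodZ _ (ideal_submod hI))].
  by rewrite /frob exprZn mulrC mulr_algl.
Qed.

Lemma len_frobenius_eventually D (V : set R) :
    V = gr D `&` I \/ V = [set 0] ->
  exists N l, forall n m, (N <= n)%N -> (c + D <= m)%N ->
    (forall d, (d < D)%N -> (d * p ^ n + c <= m)%N) ->
    (m = (D * p ^ n)%N /\ V = gr D `&` I \/ (m < D * p ^ n)%N /\ V = [set 0]) ->
  len (gr m `&` J n) = l.
Proof.
move=> hV.
have hLD := low_ideal gr I D.
have hL m : is_submodule (gr m `&` low D) by apply: (submoduleI (grS m)); exact: ideal_submod.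
have hVs : is_submodule V.
  case: hV => ->; last exact: submodule_set0.
  by apply: (submoduleI (grS D)); exact: ideal_submod.
have fV : flen_fin V.
  case: hV => ->; last by exists 0%N; exact: flen_set0.
  exact: (flen_fin_I stdR _ (ideal_submod hI)).
pose W n := V `&` frob p n @^-1` low D.
have hW n : is_submodule (W n).
  exact: (frob_preimage_submod hk n hVs (ideal_submod hLD)).
have WV n : W n `<=` V by exact: subIsetl.
have fW n : flen_fin (W n) by exact: flen_fin_sub hVs (hW n) (WV n) fV.
have [n|n|N hN] := @nondecreasing_bounded_eventually (fun n => len (W n)) (len V).
- apply: (len_le (hW n.+1) (hW n) _ (fW n.+1)) => x [Vx Lx]; split=> //.
  (* [W] increases with [n]: the next Frobenius power of x is a multiple of the current one. *)
  have := ideal_mull ((x ^+ (p ^ n)) ^+ p.-1) hLD Lx.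
  by rewrite /frob -exprS prednK // -exprM -expnSr.
- exact: (len_le hVs (hW n) (WV n) fV).
exists N, (len (gr (c + D)%N `&` low D) + (len V - len (W N)))%N => n m Nn cm hm hVm.
rewrite (frobenius_component hm hVm).
have [fF eF] := len_frob hk redR n hVs fV.
rewrite len_sumset //; [|exact: frob_submod|exact: (flen_fin_I stdR _ (ideal_submod hLD))].
congr (_ + _)%N; first by apply: (len_low_stable stdR stab).
congr (_ - _)%N => //.
(* Frobenius maps [W n] onto the intersection of the two summands and preserves its length. *)
rewrite -(hN n Nn); have [_ <-] := len_frob hk redR n (hW n) (fW n).
congr len; apply/seteqP; split.
  by move=> _ [[a Va <-] [_ La]]; exists a.
move=> _ [a [Va La] <-]; split; [by exists a|split=> //].
case: hVm => -[em eV]; rewrite eV in Va; last first.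
  by rewrite Va /frob (exp0_pchar R hk); exact: (submod0 (grS m)).
by rewrite em; apply: gr_exp; case: Va.
Qed.

(** For [u] of degree 1, [mul_exp_stable] with exponent m0 q turns u R_m into u^(m0 q) R_(m+1-m0 q),
    and u^m0 is in [I]. The case m0 = 0, where this exponent is not positive, has 1 in [I]. *)
Lemma frobenius_tail : (exists m0, gr m0 `<=` I) ->
  exists M, forall n m, (M * p ^ n <= m)%N -> gr m `<=` J n.
Proof.
move=> [m0 hm0]; exists (m0 + c.+1)%N => n m hm.
have q0 : (0 < p ^ n)%N by rewrite expn_gt0 pgt0.
have [s [_ s1 hs]] := gr_succ_gen stdR.
have hm' : (m0 * p ^ n + c.+1 <= m)%N.
  by apply: leq_trans hm; rewrite mulnDl leq_add2l leq_pmulr.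
case: m hm hm' => [|m] hm hm' z; first by lia.
move=> /hs[r [gru ->]]; rewrite big_seq; apply: (ideal_sum _ (hJ n)) => u us.
have gu := s1 _ us.
have [e0|m0n0] := posnP m0.
  have I1 : I 1 by apply: hm0; rewrite e0; exact: gr01.
  by have := @frobenius_power_mem 1 (p ^ n)%N (u * r u) I1; rewrite expr1n mul1r.
have q0' : (0 < m0 * p ^ n)%N by rewrite muln_gt0 m0n0.
have : ( *%R u @` gr (m.+1 - m0 * p ^ n + 1 * (m0 * p ^ n).-1)%N) (u * r u).
  exists (r u) => //; rewrite (_ : (_ + _ = m)%N) //.
  by move: q0' hm'; case: (m0 * p ^ n)%N => // q _; rewrite mul1n /=; lia.
rewrite (mul_exp_stable stdR redR stab gu q0'); last by lia.
move=> [t _ <-]; rewrite exprM; apply: frobenius_power_mem; apply: hm0.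
by have := gr_exp stdR m0 gu; rewrite mul1n.
Qed.

End Density.

(** * Length of R / J as the sum of the dimensions of its components *)

Section Cofinite.
Variables (RR : realType) (k : fieldType) (R : comAlgType k).
Variables (gr : nat -> set R).
Hypothesis stdR : standard_graded gr.
Local Notation grS := (gr_submod (std_grading stdR)).
Local Notation grading := (std_grading stdR).
Local Notation pr := (pr grading).
Local Notation grF := (gr_fin stdR).

Definition tail i : set R := [set x | forall j, (j < i)%N -> pr j x = 0].

Lemma tail_ideal i : is_ideal (tail i).
Proof.
apply/idealP; split; first by move=> j _; exact: pr0.
move=> a u v hu hv j ji; rewrite prD (hv j ji) addr0.
have [n /(_ n (leqnn n)) ->] := pr_sum grading a.
rewrite mulr_suml pr_bigsum big1 // => l _; rewrite (prM _ _ _ (gr_pr grading l a)).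
by case: ifP => // lj; rewrite hu ?mulr0 //; lia.
Qed.

Lemma tail_subS i : tail i.+1 `<=` tail i.
Proof. by move=> x h j ji; apply: h; exact: leqW. Qed.

Lemma gr_tail i : gr i `<=` tail i.
Proof. by move=> x gx j ji; rewrite (pr_gr _ _ gx) ltn_eqF. Qed.

Variable J : set R.
Hypothesis homJ : homogeneous grading J.
Let hJ : is_ideal J. Proof. by case: homJ. Qed.

Lemma sumset_tailI i x : sumset J (tail i.+1) x -> gr i x -> J x.
Proof.
move=> [a [t [Ja ht ->]]] gx; have : pr i (a + t) = a + t by rewrite (pr_gr _ _ gx) eqxx.
by rewrite prD (ht i (leqnn _)) addr0 => <-; case: homJ => _; apply.
Qed.

(** If [J] contained no full component, the ideals J + R_(>= i) would decrease strictly for ever.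
    Indices are reversed below to read this as an increasing chain. *)
Lemma finite_length_cofinite : (ring_length_quot RR J < +oo)%E ->
  exists m0, gr m0 `<=` J.
Proof.
move=> /chain_height_bounded[N hN]; apply: contrapT => nJ.
suff : (N.+1 <= N)%N by rewrite ltnn.
apply: (hN _ (fun i => sumset J (tail (N.+1 - i)))); split=> i hi.
  split=> //; first exact: ideal_sumset (tail_ideal _).
  exact: ideal_sumset_subl (tail_ideal _).
have -> : (N.+1 - i = (N.+1 - i.+1).+1)%N by lia.
set l := (N.+1 - i.+1)%N; split.
  by move=> _ [a [t [Ja /tail_subS ht ->]]]; exists a, t.
move=> h; apply: nJ; exists l => x gx; apply: (sumset_tailI (i := l)) => //.
by apply: h; apply: ideal_sumset_subr => //; exact: gr_tail.
Qed.

(** Elements of positive degree kill the quotient, so its R-submodules are its k-subspaces. The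
    latter are counted by the second isomorphism theorem applied to R_i. *)
Lemma flen_tail_step i :
  @flen R R^o (sumset J (tail i)) (sumset J (tail i.+1)) (len (gr i) - len (gr i `&` J)).
Proof.
have hJk := ideal_submod hJ.
have hT j := ideal_submod (tail_ideal j).
have hST j : is_ideal (sumset J (tail j)) := ideal_sumset hJ (tail_ideal j).
have [_ h] := flen_lenB (grS i) (submoduleI (grS i) hJk) (@subIsetl _ _ _) (grF i).
have eI : gr i `&` sumset J (tail i.+1) = gr i `&` J.
  apply/seteqP; split=> x [gx hx]; split=> //; first exact: sumset_tailI hx gx.
  exact: (ideal_sumset_subl (tail_ideal _)).
rewrite -{1}eI in h; move/(flen_sumset _ (grS i) (ideal_submod (hST i.+1))): h.
have decomp x : sumset J (tail i) x -> sumset (gr i) (sumset J (tail i.+1)) x.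
  move=> [a [t [Ja ht ->]]]; exists (pr i t), (a + (t - pr i t)); split.
  - exact: gr_pr.
  - exists a, (t - pr i t); split=> // j; rewrite ltnS leq_eqVlt => /orP[/eqP ->|ji].
      by rewrite -scaleN1r prD prZ (pr_gr _ _ (gr_pr grading i t)) eqxx scaleN1r subrr.
    rewrite -scaleN1r prD prZ (pr_gr _ _ (gr_pr grading i t)) (ltn_eqF ji) scaler0 addr0.
    exact: ht.
  - by rewrite [RHS]addrC -addrA subrK.
have -> : sumset (gr i) (sumset J (tail i.+1)) = sumset J (tail i).
  apply/seteqP; split=> //; apply: sumset_sub.
  - exact/ideal_submod/hST.
  - by move=> x gx; apply: ideal_sumset_subr => //; exact: gr_tail.
  - by move=> _ [a [t [Ja /tail_subS ht ->]]]; exists a, t.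
have upgrade S : sumset J (tail i.+1) `<=` S -> S `<=` sumset J (tail i) ->
    is_submodule S -> @is_submodule R R^o S.
  move=> TS ST hS; apply/idealP; split; first exact: submod0.
  move=> a u v Su Sv; apply: submodD => //.
  have [w [u' [gw hu' e]]] := decomp u (ST u Su).
  have Su' := TS _ hu'.
  have Sw : S w by rewrite -(addrK u' w) -e; exact: submodB.
  rewrite e mulrDr; apply: submodD => //; last by apply: TS; exact: ideal_mulr.
  have [n /(_ n (leqnn n)) ->] := pr_sum grading a.
  rewrite mulr_suml; apply: submod_sum => // -[[|j] jn] _ /=.
    have := gr_pr grading 0 a; rewrite (gr0E stdR) => -[b _ <-].
    by rewrite mulr_algl; exact: submodZ.
  apply: TS; apply: ideal_sumset_subr => // l li.
  rewrite (prM _ _ _ (gr_pr _ _ _)) (pr_gr _ _ gw); case: ifP => // jl.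
  by case: eqP => [|_]; [lia|rewrite mulr0].
move=> h'; suff [_] : height (@between R R^o (sumset J (tail i.+1)) (sumset J (tail i)))
    (len (gr i) - len (gr i `&` J)) <->
  height (@between k R (sumset J (tail i.+1)) (sumset J (tail i)))
    (len (gr i) - len (gr i `&` J)) by apply.
apply: (height_iso (f := id) (g := id)) => //.
  by move=> S [hS TS ST]; split=> //; exact: ideal_submod.
by move=> S [hS TS ST]; split=> //; exact: upgrade.
Qed.

Lemma ring_length_sum T : (forall m, (T <= m)%N -> gr m `<=` J) ->
  @flen R R^o setT J (\sum_(i < T) (len (gr i) - len (gr i `&` J)))%N.
Proof.
move=> hT.
have hST j : is_ideal (sumset J (tail j)) := ideal_sumset hJ (tail_ideal j).
have eJ : J = sumset J (tail T).
  apply/seteqP; split; first exact: ideal_sumset_subl (tail_ideal _).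
  apply: (@sumset_sub R R^o _ _ _ hJ) => // x hx; have [n /(_ n (leqnn n)) ->] := pr_sum grading x.
  apply: (ideal_sum _ hJ) => i _; have [iT|Ti] := ltnP i T.
    by rewrite hx //; exact: (ideal0 hJ).
  exact: (hT i Ti _ (gr_pr _ _ _)).
rewrite {1}eJ; have -> : [set: R] = sumset J (tail 0).
  by apply/seteqP; split=> // x _; apply: (ideal_sumset_subr hJ) => j.
elim: T {hT eJ} => [|T IH]; first by rewrite big_ord0; exact: (@flen_self R R^o _ (hST 0%N)).
rewrite big_ord_recr /= addnC.
have TS i : sumset J (tail i.+1) `<=` sumset J (tail i).
  by move=> _ [a [t [Ja /tail_subS ht ->]]]; exists a, t.
have T0 : sumset J (tail T) `<=` sumset J (tail 0).
  by move=> _ [a [t [Ja ht ->]]]; exists a, t.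
exact: (@flen_add R R^o _ _ _ _ _ (TS T) T0 (hST T) (hST 0%N) IH (flen_tail_step T)).
Qed.

End Cofinite.

(** * Hilbert-Kunz density *)

Section Limit.
Variables (RR : realType) (p : nat) (k : fieldType) (R : comAlgType k).
Variables (gr : nat -> set R) (I : set R).
Hypothesis hk : perfect_field p k.
Hypothesis setting : HK_setting RR gr I.

Let stdR : standard_graded gr. Proof. by case: setting. Qed.
Let redR : reduced_ring R. Proof. by case: setting. Qed.
Let dimR : krull_dim R RR = 1%E. Proof. by case: setting. Qed.
Local Notation grS := (gr_submod (std_grading stdR)).
Local Notation grading := (std_grading stdR).
Local Notation grF := (gr_fin stdR).
Let homI : homogeneous grading I.
Proof. by case: setting => _ _ _ h _; exact: homogeneous_idealP. Qed.
Let finI : (ring_length_quot RR I < +oo)%E. Proof. by case: setting. Qed.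
Let hI : is_ideal I. Proof. by case: homI. Qed.
Let pgt0 := p_gt0 R hk.
Local Notation J n := (frobenius_power I (p ^ n)).

Let hJ n : is_ideal (J n) := frobenius_power_ideal I (p ^ n).
Let pgt1 : (1 < p)%N. Proof. exact/prime_gt1/(pcharf_prime (p_pchar R hk)). Qed.
Let q0 n : (0 < p ^ n)%N. Proof. by rewrite expn_gt0 pgt0. Qed.
Let qR0 n : 0 < (p ^ n)%:R :> RR. Proof. by rewrite ltr0n. Qed.

Definition comp_len n m := (len (gr m) - len (gr m `&` J n))%N.

Lemma HK_funE n (x : RR) :
  HK_fun RR p gr I n x = if 0 <= x then (comp_len n (Num.truncn (x * (p ^ n)%:R)))%:R else 0.
Proof.
rewrite /HK_fun /component_length /comp_len; case: ifP => x0; last first.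
  have : Num.floor (x * (p ^ n)%:R) < 0.
    by rewrite floor_lt0 pmulr_llt0 // ltNge x0.
  case: Num.floor => // m _ /=.
  have -> : J n `&` [set 0] = [set 0].
    by apply/seteqP; split=> [y []//|_ ->]; split=> //; exact: (ideal0 (hJ n)).
  by rewrite (length_quotE _ (flen_self (submodule_set0 R))).
have : (0 <= Num.floor (x * (p ^ n)%:R)) by rewrite floor_ge0 mulr_ge0.
have := truncEfloor (x * (p ^ n)%:R); case: Num.floor => // m -> _ /=.
have hJk := ideal_submod (hJ n).
have [_ h] := flen_lenB (grS m) (submoduleI (grS m) hJk) (@subIsetl _ _ _) (grF m).
by rewrite setIC (length_quotE _ h).
Qed.

(** This serves x = 0, where the degree stays 0 and never reaches the stable range. R_0 is a field,
    so an ideal meets it in 0 or contains 1, and [I] contains 1 exactly when its Frobenius power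
    does. *)
Lemma gr0_frobenius n : gr 0%N `&` J n = gr 0%N `&` I.
Proof.
have one (K : set R) a : is_ideal K -> a != 0 -> K (a%:A) -> K 1.
  move=> hK a0 Ka; rewrite -[1]scale1r -(mulVf a0) -scalerA.
  exact: (submodZ _ (ideal_submod hK)).
apply/seteqP; split=> x [gx hx]; split=> //; move: gx hx; rewrite (gr0E stdR) => -[a _ <-].
  move=> Ja; apply: (ideal_gen_min hI _ Ja) => _ [b Ib <-].
  by rewrite -(prednK (q0 n)) exprS; exact: (ideal_mull _ hI).
move=> Ia; have [->|a0] := eqVneq a 0; first by rewrite scale0r; exact: (ideal0 (hJ n)).
have := @frobenius_power_mem _ _ I 1 (p ^ n)%N (a%:A) (one _ _ hI a0 Ia).
by rewrite expr1n mul1r.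
Qed.

Lemma HK_fun_eventually (x : RR) :
  exists N l, forall n, (N <= n)%N -> HK_fun RR p gr I n x = l.
Proof.
have [x0|x0|x0] := ltrgt0P x.
- have [c [e [stab _]]] := stable_exists stdR redR dimR.
  set t := Num.truncn x.
  have /andP[tx xt] : t%:R <= x < t.+1%:R by apply: truncn_itv; exact: ltW.
  (* [D] is the ceiling of [x], and [delta] the gap between [x] and the largest integer below it: 1
     at an integer, the fractional part otherwise. *)
  have [D [V [delta [d0 hd hV1 hV2]]]] : exists D V (delta : RR), [/\ 0 < delta,
      forall d, (d < D)%N -> d%:R + delta <= x,
      V = gr D `&` I \/ V = [set 0] &
      (x = D%:R /\ V = gr D `&` I \/ x < D%:R /\ V = [set 0])].
    have [xt'|nxt] := eqVneq x t%:R.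
      exists t, (gr t `&` I), 1; split=> //; [|by left|by left].
      by move=> d dt; rewrite xt' natr1 ler_nat.
    exists t.+1, [set 0], (x - t%:R); split=> //; [|  |by right|by right].
      by rewrite subr_gt0 lt_neqAle eq_sym nxt.
    by move=> d; rewrite ltnS -(ler_nat RR) => dt; lra.
  have [N [l hN]] := len_frobenius_eventually hk redR stab homI hV1.
  (* The first quotient ensures c <= delta q, the second c + D <= x q; since n < p^n, bounding [n]
     is enough. *)
  exists (maxn N (Num.truncn (c%:R / delta + (c + D)%:R / x)).+1), (e - l)%:R => n.
  rewrite geq_max => /andP[Nn hn].
  have le_q : c%:R / delta + (c + D)%:R / x <= (p ^ n)%:R.
    apply: ltW; apply: lt_le_trans (truncnS_gt _) _.
    rewrite ler_nat; apply: leq_trans hn _; exact/ltnW/ltn_expl.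
  have cq : c%:R <= delta * (p ^ n)%:R.
    rewrite mulrC -ler_pdivrMr //; apply: le_trans le_q.
    by rewrite lerDl divr_ge0 // ltW.
  have cDq : (c + D)%:R <= x * (p ^ n)%:R.
    rewrite mulrC -ler_pdivrMr //; apply: le_trans le_q.
    by rewrite lerDr divr_ge0 // ltW.
  rewrite HK_funE (ltW x0) /comp_len.
  set m := Num.truncn _.
  have mge a : a%:R <= x * (p ^ n)%:R -> (a <= m)%N.
    by move=> h; rewrite truncn_ge_nat // mulr_ge0 // ltW.
  have cDm := mge _ cDq.
  have [_ he _] := stab; rewrite he; last by apply: leq_trans cDm; exact: leq_addr.
  rewrite (hN n m) //.
    move=> d dD; apply: mge; rewrite natrD natrM.
    apply: (@le_trans _ _ ((d%:R + delta) * (p ^ n)%:R)).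
      by rewrite mulrDl lerD2l.
    by rewrite ler_pM2r // hd.
  case: hV2 => -[xD eV]; [left|right]; split=> //.
    by rewrite /m xD -natrM natrK.
  rewrite ltnNge; apply/negP => Dm.
  have : (D * p ^ n)%:R <= x * (p ^ n)%:R.
    by rewrite -truncn_ge_nat // mulr_ge0 // ltW.
  by rewrite natrM ler_pM2r // leNgt xD.
- by exists 0%N, 0 => n _; rewrite HK_funE leNgt x0.
- exists 0%N, (comp_len 0 0)%:R => n _.
  by rewrite HK_funE x0 lexx mul0r truncn0 /comp_len !gr0_frobenius.
Qed.

Lemma HK_fun_cvg (x : RR) : HK_fun RR p gr I ^~ x @ \oo --> HK_density RR p gr I x.
Proof.
have [N [l hN]] := HK_fun_eventually x.
have h : HK_fun RR p gr I ^~ x @ \oo --> l.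
  by apply: cvg_near_cst; exists N => // n /= /hN.
by rewrite /HK_density; move/cvg_lim: (h) => ->.
Qed.

Lemma HK_fun_bound : exists B M : nat,
  (forall n m, (comp_len n m <= B)%N) /\
  (forall n m, (M * p ^ n <= m)%N -> gr m `<=` J n).
Proof.
have [c [e [stab [B hB]]]] := stable_exists stdR redR dimR.
have [M hM] := frobenius_tail hk stdR redR stab (finite_length_cofinite homI finI).
exists B, M; split=> // n m; apply: leq_trans (hB m); exact: leq_subr.
Qed.

Lemma comp_len_tail n m : gr m `<=` J n -> comp_len n m = 0%N.
Proof. by move=> h; rewrite /comp_len (setIidl h) subnn. Qed.

(** The set where floor(xq) = i, of measure 1/q for q = p^n. *)
Definition step n i : set RR := `[i%:R / (p ^ n)%:R, i.+1%:R / (p ^ n)%:R[%classic.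

Lemma HK_fun_step n T (x : RR) : (forall m, (T <= m)%N -> gr m `<=` J n) ->
  HK_fun RR p gr I n x = \sum_(i < T) (comp_len n i)%:R * \1_(step n i) x.
Proof.
move=> hT; rewrite HK_funE.
have mem i : (\1_(step n i) x : RR) = ((0 <= x) && (i == Num.truncn (x * (p ^ n)%:R)))%:R.
  rewrite indicE; congr ((nat_of_bool _)%:R); apply/idP/idP.
    rewrite inE /step /= in_itv /= ler_pdivrMr // ltr_pdivlMr // => /andP[h1 h2].
    have x0 : 0 <= x by rewrite -(pmulr_lge0 _ (qR0 n)); exact: le_trans h1.
    by rewrite x0 /= eq_sym truncn_eq ?h1 ?h2 // mulr_ge0.
  move=> /andP[x0]; rewrite eq_sym truncn_eq ?mulr_ge0 // => /andP[h1 h2].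
  by rewrite inE /step /= in_itv /= ler_pdivrMr // ltr_pdivlMr // h1 h2.
case: ifP => x0; last by rewrite big1 // => i _; rewrite mem x0 mulr0.
set m := Num.truncn _; have [mT|Tm] := ltnP m T.
  rewrite (bigD1 (Ordinal mT)) //= mem x0 eqxx mulr1 big1 ?addr0 // => i ne.
  rewrite mem x0 /=; case: eqP => [e|_]; last by rewrite mulr0.
  by move/eqP: ne; case; apply: val_inj.
rewrite comp_len_tail; last exact: hT.
by rewrite big1 // => i _; rewrite mem x0 ltn_eqF ?mulr0 // (leq_trans _ Tm).
Qed.

Lemma measurable_step n i : measurable (step n i).
Proof. exact: measurable_itv. Qed.

Lemma HK_fun_measurable n :
  measurable_fun setT (fun x : RR => (HK_fun RR p gr I n x)%:E).
Proof.
have [B [M [_ hM]]] := HK_fun_bound.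
apply/measurable_EFinP.
have -> : HK_fun RR p gr I n =
    fun x => \sum_(i < M * p ^ n) (comp_len n i)%:R * \1_(step n i) x.
  by apply/funext => x; apply: HK_fun_step => m; exact: hM.
apply: measurable_sum => i; apply: measurable_funM => //.
exact: (measurable_indic (measurable_step _ _)).
Qed.

Lemma HK_fun_integral n :
  (\int[@lebesgue_measure RR]_x (HK_fun RR p gr I n x)%:E = HK_seq RR p I n)%E.
Proof.
have [B [M [_ hM]]] := HK_fun_bound.
have hT m : (M * p ^ n <= m)%N -> gr m `<=` J n by exact: hM.
rewrite /HK_seq /ring_length_quot (length_quotE _ (ring_length_sum
  (frobenius_power_homogeneous hk homI n) hT)).
transitivity (\int[@lebesgue_measure RR]_x \sum_(i < M * p ^ n)
    ((comp_len n i)%:R * \1_(step n i) x)%:E)%E.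
  by apply: eq_integral => x _; rewrite (HK_fun_step x hT) sumEFin.
rewrite ge0_integral_sum; last 3 first.
- exact: measurableT.
- move=> i; apply/measurable_EFinP; apply: measurable_funM => //.
  exact: (measurable_indic (measurable_step _ _)).
- by move=> i x _; rewrite lee_fin mulr_ge0.
rewrite natr_sum -sumEFin ge0_sume_distrl; last by move=> i _; rewrite lee_fin.
apply: eq_bigr => i _.
transitivity ((comp_len n i)%:R%:E *
    \int[@lebesgue_measure RR]_x (\1_(step n i) x)%:E)%E.
  have := @integralZl_indic _ _ RR (@lebesgue_measure RR) setT measurableT
    (fun=> step n i) (comp_len n i)%:R.
  rewrite /= => -> //; first by rewrite ltNge ler0n.
  exact: measurable_step.
rewrite integral_indic //; last exact: measurable_step.
rewrite setIT /comp_len; congr (_ * _)%E.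
rewrite /step [LHS]lebesgue_measure_itv /= lte_fin ltr_pM2r ?invr_gt0 // ltr_nat ltnSn.
by rewrite -EFinB -mulrBl -natr1 addrAC subrr add0r mul1r.
Qed.

Lemma HK_density_integral :
  [/\ forall x : RR, 0 <= x -> cvgn (fun n => HK_fun RR p gr I n x),
      (@lebesgue_measure RR).-integrable setT
        (fun x => (HK_density RR p gr I x)%:E),
      cvgn (HK_seq RR p I)
    & HK_multiplicity RR p I =
        (\int[@lebesgue_measure RR]_x (HK_density RR p gr I x)%:E)%E].
Proof.
have [B [M [hB hM]]] := HK_fun_bound.
pose g (x : RR) : \bar RR := (B%:R * \1_(`[0, M%:R]%classic) x)%:E.
have mdens : measurable_fun setT (fun x : RR => (HK_density RR p gr I x)%:E).
  apply/measurable_EFinP.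
  apply: (measurable_fun_cvg (h := HK_fun RR p gr I)).
    by move=> n; apply/measurable_EFinP; exact: HK_fun_measurable.
  by move=> x _; exact: HK_fun_cvg.
have ig : (@lebesgue_measure RR).-integrable setT g.
  have mI : measurable (`[0, M%:R]%classic : set RR) by exact: measurable_itv.
  have mg : measurable_fun setT g.
    apply/measurable_EFinP; apply: measurable_funM => //.
  apply/integrableP; split; first exact: mg.
  rewrite (_ : integral _ _ _ = (B%:R%:E *
      \int[@lebesgue_measure RR]_x (\1_(`[0%R, M%:R]%classic) x)%:E)%E); last first.
    have <- := @integralZl_indic _ _ RR (@lebesgue_measure RR) setT measurableT
      (fun=> `[0%R, M%:R]%classic) B%:R.
    - by apply: eq_integral => x _; rewrite gee0_abs // lee_fin mulr_ge0.
    - by rewrite ltNge ler0n.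
    - exact: mI.
  rewrite integral_indic // setIT.
  have fin (y : \bar RR) : y = (M%:R)%:E -> ((B%:R : RR)%:E * y < +oo)%E.
    by move=> ->; rewrite -EFinM ltry.
  apply: fin; rewrite [LHS]lebesgue_measure_itv /= lte_fin ltr0n.
  by case: (posnP M) => [->//|_]; rewrite oppr0 adde0.
have [id cv] : (@lebesgue_measure RR).-integrable setT
    (fun x => (HK_density RR p gr I x)%:E) /\ HK_seq RR p I @ \oo -->
    (\int[@lebesgue_measure RR]_x (HK_density RR p gr I x)%:E)%E.
  have [] := @dominated_convergence _ _ RR (@lebesgue_measure RR) setT
    measurableT (fun n x => (HK_fun RR p gr I n x)%:E)
    (fun x => (HK_density RR p gr I x)%:E) g.
  - exact: HK_fun_measurable.
  - exact: mdens.
  - apply: measure_negligible.aeW => x _; apply: cvg_EFin; first exact: nearW.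
    exact: HK_fun_cvg.
  - exact: ig.
  - apply: measure_negligible.aeW => x n _; rewrite /g HK_funE.
    rewrite lee_fin.
    case: ifPn => x0; last by rewrite normr0 mulr_ge0 // indicE ler0n.
    rewrite normr_nat indicE; case: (boolP (x \in _)) => xM; first by rewrite mulr1 ler_nat.
    (* Here x exceeds [M], so the degree is at least M q and the component vanishes. *)
    rewrite comp_len_tail ?mulr_ge0 //; apply: hM.
    rewrite truncn_ge_nat ?mulr_ge0 // natrM ler_pM2r //.
    apply: ltW; rewrite ltNge; apply: contra xM => xM.
    by rewrite inE /= in_itv /= x0.
  - move=> id _ cv; split=> //; rewrite (_ : HK_seq RR p I = (fun n =>
      \int[@lebesgue_measure RR]_x (HK_fun RR p gr I n x)%:E)%E) //.
    by apply/funext => n; rewrite HK_fun_integral.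
split=> //.
- by move=> x _; apply/cvg_ex; eexists; exact: HK_fun_cvg.
- by apply/cvg_ex; eexists; exact: cv.
- exact/cvg_lim.
Qed.
End Limit.

(** * The node *)

Section Node.
Variable k : fieldType.

Definition node_pred : {pred {poly k} * {poly k}} := [pred x | x.1.[0] == x.2.[0]].

Lemma node_closed : GRing.subalg_closed node_pred.
Proof.
split.
- by rewrite inE.
- move=> a u v; rewrite !inE => /eqP eu /eqP ev.
  by rewrite /= !hornerE eu ev.
- by move=> u v; rewrite !inE => /eqP eu /eqP ev; rewrite /= !hornerM eu ev.
Qed.

HB.instance Definition _ := GRing.isSubalgClosed.Build k _ node_pred node_closed.

(* k[X, Y] / (XY), realised as the pairs of polynomials that agree at 0. *)
Record node := Node { node_val :> {poly k} * {poly k}; _ : node_val \in node_pred }.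

HB.instance Definition _ := [isSub for node_val].
HB.instance Definition _ := [Choice of node by <:].
HB.instance Definition _ := [SubChoice_isSubLalgebra of node by <:].
HB.instance Definition _ := [SubLalgebra_isSubAlgebra of node by <:].
HB.instance Definition _ := [SubNzRing_isSubComNzRing of node by <:].

(** Restriction to one of the two lines; the boolean index lets the symmetric arguments be made
    once. *)
Definition branch (b : bool) (x : node) : {poly k} := if b then (\val x).1 else (\val x).2.

Arguments branch : simpl never.

Lemma node_eq (x y : node) : (forall b, branch b x = branch b y) -> x = y.
Proof.
move=> h; apply: val_inj; move: (h true) (h false); rewrite /branch.
by case: (\val x) (\val y) => [? ?] [? ?] /= -> ->.
Qed.

Lemma branch0 b : branch b 0 = 0. Proof. by case: b. Qed.
Lemma branch1 b : branch b 1 = 1. Proof. by case: b. Qed.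
Lemma branchD b x y : branch b (x + y) = branch b x + branch b y.
Proof. by case: b. Qed.
Lemma branchN b x : branch b (- x) = - branch b x.
Proof. by case: b. Qed.
Lemma branchZ b a x : branch b (a *: x) = a *: branch b x.
Proof. by case: b. Qed.
Lemma branchM b x y : branch b (x * y) = branch b x * branch b y.
Proof. by case: b. Qed.
Lemma branchX b x n : branch b (x ^+ n) = branch b x ^+ n.
Proof. by elim: n => [|n IH]; rewrite ?branch1 // !exprS branchM IH. Qed.
Lemma branch_sum b (I : Type) (r : seq I) (P : pred I) (F : I -> node) :
  branch b (\sum_(i <- r | P i) F i) = \sum_(i <- r | P i) branch b (F i).
Proof. by apply: (big_morph (branch b)); [exact: branchD|exact: branch0]. Qed.

Lemma branch_at0 b x : (branch b x).[0] = (branch true x).[0].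
Proof.
by case: b => //; case: x => [[f g] h]; have := h; rewrite inE => /eqP.
Qed.

Lemma node_ex (f : bool -> {poly k}) : (f true).[0] = (f false).[0] ->
  exists x : node, forall b, branch b x = f b.
Proof.
move=> e; have h : (f true, f false) \in node_pred by rewrite inE; apply/eqP.
by exists (Node h) => -[].
Qed.

Lemma diag_ex (f : {poly k}) : exists x : node, forall b, branch b x = f.
Proof. exact: (@node_ex (fun=> f)). Qed.

Lemma axis_ex b (f : {poly k}) : f.[0] = 0 ->
  exists x : node, branch b x = f /\ branch (~~ b) x = 0.
Proof.
move=> f0; have [|x hx] := @node_ex (fun b' => if b' == b then f else 0).
  by case: b; rewrite /= !hornerE f0.
by exists x; rewrite !hx eqxx; case: b {hx}.
Qed.

Lemma poly_ideal_principal (P : set {poly k}) : is_ideal P ->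
  exists2 g, P g & forall f, P f -> g %| f.
Proof.
move=> hP; have [h|nz] := pselect (forall f, P f -> f = 0).
  by exists 0; [exact: ideal0|move=> f /h ->; exact: dvdp0].
have ex : exists n, `[< exists f, [/\ P f, f != 0 & size f = n] >].
  apply: contrapT => h; apply: nz => f Pf; apply/eqP; apply: contrapT => /negP f0.
  by apply: h; exists (size f); apply/asboolP; exists f.
case: (ex_minnP ex) => n /asboolP[g [Pg g0 sg]] hn; exists g => // f Pf.
apply: contrapT => /negP; rewrite /dvdp -/(_ %% _) => r0.
have := ltn_modp f g; rewrite g0 sg ltnNge => /negP; apply; apply: hn.
apply/asboolP; exists (f %% g); split=> //.
have -> : f %% g = f - (f %/ g) * g by rewrite {2}(divp_eq f g) addrC addKr.
by apply: idealB => //; exact: ideal_mulr.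
Qed.

(** The kernel and the image of [branch false] on the ideal are both ideals of k[X], hence
    principal. A generator of the first and a lift of a generator of the second generate; diagonal
    elements lift the multipliers. *)
Lemma node_noetherian : noetherian_ring node.
Proof.
move=> I hI.
pose I1 := [set f | exists2 x, I x & branch true x = f /\ branch false x = 0].
pose I2 := [set f | exists2 x, I x & branch false x = f].
have id1 : is_ideal I1.
  apply/idealP; split; first by exists 0; rewrite ?branch0 //; exact: ideal0.
  move=> a _ _ [x Ix [<- x0]] [y Iy [<- y0]]; have [d hd] := diag_ex a.
  exists (d * x + y); first by apply: idealD => //; exact: ideal_mulr.
  by rewrite !branchD !branchM !hd x0 y0 mulr0 addr0.
have id2 : is_ideal I2.
  apply/idealP; split; first by exists 0; rewrite ?branch0 //; exact: ideal0.
  move=> a _ _ [x Ix <-] [y Iy <-]; have [d hd] := diag_ex a.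
  exists (d * x + y); first by apply: idealD => //; exact: ideal_mulr.
  by rewrite branchD branchM hd.
have [_ [u Iu [<- u0]] hu] := poly_ideal_principal id1.
have [_ [v Iv <-] hv] := poly_ideal_principal id2.
exists [:: u; v]; apply/seteqP; split; last first.
  by apply: ideal_gen_min => // x /=; rewrite !inE => /orP[] /eqP ->.
move=> x Ix; have hg := ideal_gen_ideal [set` [:: u; v]].
have gu : ideal_gen [set` [:: u; v]] u by apply: sub_ideal_gen; rewrite /= !inE eqxx.
have gv : ideal_gen [set` [:: u; v]] v by apply: sub_ideal_gen; rewrite /= !inE eqxx orbT.
have /dvdpP[h eh] : branch false v %| branch false x by apply: hv; exists x.
have [d hd] := diag_ex h.
have Iy : I (x - d * v) by apply: idealB => //; exact: ideal_mulr.
have y0 : branch false (x - d * v) = 0 by rewrite branchD branchN branchM hd eh subrr.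
have /dvdpP[h' eh'] : branch true u %| branch true (x - d * v).
  by apply: hu; exists (x - d * v).
have [d' hd'] := diag_ex h'.
have -> : x = d' * u + d * v.
  apply: (addIr (- (d * v))); rewrite addrK; apply: node_eq => -[].
    by rewrite eh' branchM hd'.
  by rewrite y0 branchM u0 mulr0.
by apply: (idealD hg); exact: (ideal_mulr _ hg).
Qed.

Lemma node_reduced : reduced_ring node.
Proof.
move=> x n e; apply: node_eq => b; apply/eqP; rewrite branch0.
by have /eqP := congr1 (branch b) e; rewrite branchX branch0 expf_eq0 => /andP[].
Qed.

(** For [m = 0] the agreement at 0 forces the two coefficients to be equal, so degree 0 is a line;
    in positive degrees they are independent. *)
Definition node_gr (m : nat) : set node :=
  [set x | exists a : bool -> k, forall b, branch b x = a b *: 'X^m].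

Lemma node_gr_coef m x b i : node_gr m x -> i != m -> (branch b x)`_i = 0.
Proof. by move=> [a ->] /negPf im; rewrite coefZ coefXn im mulr0. Qed.

Lemma node_gr_submod m : is_submodule (node_gr m).
Proof.
apply/submoduleP; split; first by exists (fun=> 0) => b; rewrite branch0 scale0r.
move=> c x y [a ha] [a' ha']; exists (fun b => c * a b + a' b) => b.
by rewrite branchD branchZ ha ha' scalerDl scalerA.
Qed.

Lemma node_grading : is_grading node_gr.
Proof.
split.
- exact: node_gr_submod.
- move=> m n x y [a ha] [a' ha']; exists (fun b => a b * a' b) => b.
  by rewrite branchM ha ha' -scalerAl -scalerAr scalerA -exprD.
- move=> x.
  have /choice[f hf] : forall i, exists y : node, forall b, branch b y = (branch b x)`_i *: 'X^i.
    move=> i; apply: node_ex; case: i => [|i]; last by rewrite !hornerE !expr0n !mulr0.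
    by rewrite -!horner_coef0 !branch_at0.
  exists (maxn (size (branch true x)) (size (branch false x))), f; split.
    by move=> i; exists (fun b => (branch b x)`_i) => b.
  apply: node_eq => b; rewrite branch_sum.
  under eq_bigr do rewrite hf.
  rewrite -poly_def; apply/polyP => i; rewrite coef_poly; case: ltnP => // hi.
  by rewrite nth_default //; apply: leq_trans hi; case: b; rewrite leq_max leqnn ?orbT.
- move=> n a ga e i hi; apply: node_eq => b; rewrite branch0.
  have [c hc] := ga i; rewrite hc; suff -> : c b = 0 by rewrite scale0r.
  have := congr1 (fun x => (branch b x)`_i) e.
  rewrite branch_sum coef_sum branch0 coef0 (bigD1 (Ordinal hi)) //= big1 ?addr0.
    by rewrite hc coefZ coefXn eqxx mulr1.
  by move=> j ne; apply: (node_gr_coef _ (ga j)); rewrite eq_sym.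
Qed.

Lemma node_standard : standard_graded node_gr.
Proof.
split; [exact: node_noetherian|exact: node_grading| |].
- apply/seteqP; split=> [x [a ha]|_ [c _ <-]]; last first.
    by exists (fun=> c) => b; rewrite branchZ branch1.
  exists (a true) => //; apply: node_eq => b; rewrite branchZ branch1 ha.
  by congr (_ *: _); have := branch_at0 b x; rewrite !ha !hornerE.
- apply/seteqP; split=> // x _ S [[S1 Sl Sm] gS].
  move: S1; rewrite inE => S1.
  have SM u v : S u -> S v -> S (u * v) by move=> Su Sv; have := Sm u v; rewrite !inE; apply.
  have hS : is_submodule S.
    apply/submoduleP; split; last by move=> a u v Su Sv; have := Sl a u v; rewrite !inE; apply.
    by have := Sl (-1) 1 1; rewrite !inE scaleN1r addNr; apply.
  have [n [a [ga ->]]] : exists n (a : nat -> node),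
      (forall i, node_gr i (a i)) /\ x = \sum_(i < n) a i.
    by case: node_grading => _ _ h _; exact: h.
  apply: submod_sum => // -[i _] _ /=; have [c hc] := ga i.
  case: i hc => [|i] hc.
    have -> : a 0%N = c true *: 1; last exact: submodZ.
    apply: node_eq => b; rewrite branchZ branch1 hc.
    by congr (_ *: _); have := branch_at0 b (a 0%N); rewrite !hc !hornerE.
  (* The two monomials of a positive degree are powers of the degree 1 elements X and Y. *)
  have axis b : exists y : node, [/\ branch b y = 'X^(i.+1), branch (~~ b) y = 0 & S y].
    have [|z [zb zb']] := @axis_ex b 'X; first by rewrite hornerX.
    exists (z ^+ i.+1); rewrite !branchX zb zb' expr0n; split=> //.
    have Sz : S z.
      apply: gS; exists (fun b' => if b' == b then 1 else 0) => b'.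
      case: eqP => [->|/eqP ne]; first by rewrite zb scale1r.
      by rewrite scale0r -zb'; congr branch; move: ne; case: b' b {zb zb'} => -[].
    elim: i {hc} => [|i IH]; first by rewrite expr1.
    by rewrite exprS; exact: SM.
  have [y [yt yf Sy]] := axis true; have [z [zf zt Sz]] := axis false.
  rewrite /= in yf zt.
  have -> : a i.+1 = c true *: y + c false *: z.
    apply: node_eq => -[]; rewrite branchD !branchZ hc ?yt ?yf ?zt ?zf.
      by rewrite scaler0 addr0.
    by rewrite scaler0 add0r.
  by apply: submodD => //; exact: submodZ.
Qed.

Definition node_max : set node := [set x | (branch true x).[0] = 0].

Lemma node_max_ideal : is_ideal node_max.
Proof.
apply/idealP; split; first by rewrite /node_max /= branch0 hornerC.
move=> a u v; rewrite /node_max /= => hu hv.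
by rewrite branchD branchM !hornerE hu hv mulr0 addr0.
Qed.

Lemma node_max_prime : is_prime_ideal node_max.
Proof.
apply/is_prime_idealP; split; [exact: node_max_ideal| |].
  by rewrite /node_max /= branch1 hornerC; apply/eqP; exact: oner_neq0.
move=> u v; rewrite /node_max /= branchM hornerM => /eqP.
by rewrite mulf_eq0 => /orP[] /eqP; auto.
Qed.

Lemma node_axis_prime : is_prime_ideal [set x | branch true x = 0].
Proof.
apply/is_prime_idealP; split.
- apply/idealP; split; first by rewrite /= branch0.
  by move=> a u v /= hu hv; rewrite branchD branchM hu hv mulr0 addr0.
- by rewrite /= branch1; apply/eqP; exact: oner_neq0.
- move=> u v; rewrite /= branchM => /eqP.
  by rewrite mulf_eq0 => /orP[] /eqP; auto.
Qed.

(** Let [g] and [f] generate [Q] and [M], with g = h f nonzero. Primality of [Q] puts h in [Q],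
    making [f] a unit, or [f] in [Q], making [M] equal to [Q]. *)
Lemma poly_prime_chain (P Q M : set {poly k}) : is_prime_ideal P -> is_prime_ideal Q ->
  is_prime_ideal M -> P `<` Q -> Q `<` M -> False.
Proof.
move=> /is_prime_idealP[hP _ _] /is_prime_idealP[hQ _ Qp] /is_prime_idealP[hM M1 _].
move=> [_ nQP] [QM nMQ].
have [g Qg hg] := poly_ideal_principal hQ.
have [f Mf hf] := poly_ideal_principal hM.
have g0 : g != 0.
  apply/eqP => g0; apply: nQP => x /hg; rewrite g0 dvd0p => /eqP ->; exact: ideal0.
have /dvdpP[h eg] := hf _ (QM _ Qg).
have [Qh|Qf] : Q h \/ Q f by apply: Qp; rewrite -eg.
  have /dvdpP[t et] := hg _ Qh.
  have e1 : t * f = 1.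
    by apply: (mulfI g0); rewrite mulr1 [g in RHS]eg et mulrAC [g * _]mulrC.
  by apply: M1; rewrite -e1; exact: ideal_mulr.
apply: nMQ => x /hf /dvdpP[t ->]; exact: ideal_mulr.
Qed.

Lemma node_krull (RR : realType) : krull_dim node RR = 1%E.
Proof.
suff h : height (@is_prime_ideal node) 1 by rewrite /krull_dim (chain_heightE _ h).
split.
  exists (fun i => if i == 0%N then [set x | branch true x = 0] else node_max); split.
    by move=> [|i] _; [exact: node_axis_prime|exact: node_max_prime].
  move=> [|//] _; split.
    by move=> x /= e; rewrite /node_max /= e hornerC.
  move=> /= h; have [|x [xt _]] := @axis_ex true 'X; first by rewrite hornerX.
  have : branch true x = 0 by apply: h; rewrite /node_max /= xt hornerX.
  by rewrite xt => /eqP; rewrite polyX_eq0.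
move=> n C [QC ltC]; rewrite leqNgt; apply/negP => n2.
have C0 := QC 0%N isT; have C1 := QC 1%N (ltnW n2); have C2 := QC 2%N n2.
have lt01 : C 0%N `<` C 1%N by apply: ltC; exact: ltn_trans n2.
have lt12 := ltC 1%N n2.
(* Since XY = 0, the smallest prime contains X or Y, and with it the kernel of restriction to the
   other line. *)
have [b hb] : exists b, forall x, branch (~~ b) x = 0 -> C 0%N x.
  have X0 : ('X : {poly k}).[0] = 0 by rewrite hornerX.
  have [y [yt yf]] := axis_ex true X0; have [z [zf zt]] := axis_ex false X0.
  have /is_prime_idealP[h0 _ p0] := C0.
  have : C 0%N (y * z).
    have -> : y * z = 0; last exact: ideal0.
    by apply: node_eq => -[]; rewrite branchM branch0 ?zt ?yf ?mulr0 ?mul0r.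
  have key b w : branch b w = 'X -> branch (~~ b) w = 0 -> C 0%N w ->
      forall x, branch (~~ b) x = 0 -> C 0%N x.
    move=> wb wb' Cw x xb'.
    have /dvdpP[f ef] : 'X %| branch b x.
      have := dvdp_XsubCl (branch b x) 0; rewrite subr0 => ->.
      by rewrite /root branch_at0 -(branch_at0 (~~ b)) xb' hornerC.
    have [d hd] := diag_ex f.
    have -> : x = d * w; last exact: ideal_mulr.
    apply: node_eq => b'; rewrite branchM hd; have [->|] := eqVneq b' b; first by rewrite wb.
    by case: b' b wb wb' xb' {ef} => -[] //= _ -> -> _; rewrite mulr0.
  by move=> /p0[Cy|Cz]; [exists true; exact: (key true y)|exists false; exact: (key false z)].
(* All members of the chain contain that kernel, so they are the preimages of their images in k[X],
   where [poly_prime_chain] applies. *)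
pose D i : set {poly k} := [set f | exists2 x, C i x & branch (~~ b) x = f].
have mem i x : C 0%N `<=` C i -> is_ideal (C i) -> D i (branch (~~ b) x) -> C i x.
  move=> sub hC [y Cy e]; rewrite -(subrK y x); apply: idealD => //; apply: sub; apply: hb.
  by rewrite branchD branchN e subrr.
have s0 : C 0%N `<=` C 0%N by [].
have s1 : C 0%N `<=` C 1%N by exact: properW.
have s2 : C 0%N `<=` C 2%N by apply: subset_trans s1 _; exact: properW.
have Dprime i : C 0%N `<=` C i -> is_prime_ideal (C i) -> is_prime_ideal (D i).
  move=> sub /is_prime_idealP[hC C1' pC]; apply/is_prime_idealP; split.
  - apply/idealP; split; first by exists 0; [exact: ideal0|exact: branch0].
    move=> a _ _ [x Cx <-] [y Cy <-]; have [d hd] := diag_ex a.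
    exists (d * x + y); first by apply: idealD => //; exact: ideal_mulr.
    by rewrite branchD branchM hd.
  - by rewrite -(branch1 (~~ b)) => /(mem _ _ sub hC).
  - move=> u v; have [x hx] := diag_ex u; have [y hy] := diag_ex v.
    rewrite -(hx (~~ b)) -(hy (~~ b)) -branchM => /(mem _ _ sub hC) /pC[] h; [left|right].
      by exists x.
    by exists y.
have Dlt i j : C 0%N `<=` C i -> is_ideal (C i) -> C i `<` C j -> D i `<` D j.
  move=> sub hC [ij nij]; split; first by move=> _ [x /ij Cx <-]; exists x.
  by move=> h; apply: nij => x Cx; apply: mem => //; apply: h; exists x.
have i0 : is_ideal (C 0%N) by case/is_prime_idealP: C0.
have i1 : is_ideal (C 1%N) by case/is_prime_idealP: C1.
exact: (poly_prime_chain (Dprime _ s0 C0) (Dprime _ s1 C1) (Dprime _ s2 C2)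
  (Dlt _ _ s0 i0 lt01) (Dlt _ _ s1 i1 lt12)).
Qed.

Lemma node_max_length (RR : realType) : (ring_length_quot RR node_max < +oo)%E.
Proof.
have Q : @between node node^o node_max setT node_max by split=> //; exact: node_max_ideal.
have [|n hn _] := @bounded_height _ _ 1 _ Q; last first.
  by rewrite /ring_length_quot (@length_quotE node node^o _ _ _ _ hn) ltry.
apply: (rank_bound (rho := fun S => `[< S 1 >] : nat)); first by move=> S _; case: asboolP.
have one S : is_ideal S -> S 1 -> forall x, S x.
  by move=> hS S1 x; rewrite -[x]mulr1; exact: ideal_mulr.
move=> S S' [hS S0 _] [hS' S0' _] [SS' nSS'].
case: asboolP => [S1|nS1]; first by exfalso; apply: nSS' => x _; exact: one.
case: asboolP => [//|nS1']; exfalso; apply: nSS' => x S'x; apply: S0.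
apply: contrapT => x0; apply: nS1'.
have c0 : (branch true x).[0] != 0 by apply/eqP.
have -> : 1 = ((branch true x).[0]^-1)%:A * (x - (x - ((branch true x).[0])%:A)).
  by rewrite opprB addrC subrK mulr_algl scalerA mulVf // scale1r.
apply: ideal_mulr => //; apply: idealB => //; apply: S0'.
by rewrite /node_max /= branchD branchN branchZ branch1 !hornerE subrr.
Qed.

Lemma node_setting (RR : realType) : HK_setting RR node_gr node_max.
Proof.
split; [exact: node_standard|exact: node_reduced|exact: node_krull| |exact: node_max_length].
split; first exact: node_max_ideal.
move=> n a ga; rewrite /node_max /= branch_sum horner_sum => e i hi.
have [c hc] := ga i; case: i hi c hc => [|i] hi c hc; last by rewrite hc !hornerE expr0n mulr0.
move: e; rewrite (bigD1 (Ordinal hi)) //= big1 ?addr0 // => -[[|j] hj] ne //.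
by have [c' ->] := ga j.+1; rewrite !hornerE expr0n mulr0.
Qed.

Lemma node_gr_len m : (0 < m)%N -> (2 <= len (node_gr m))%N.
Proof.
move=> m0; have [_ chain_le] := lenP (gr_fin node_standard m).
have X0 : ('X^m : {poly k}).[0] = 0 by rewrite hornerXn expr0n gtn_eqF.
have Xm : 'X^m != 0 :> {poly k} by rewrite -size_poly_eq0 size_polyXn.
have inb b x : branch b x = 'X^m -> branch (~~ b) x = 0 -> node_gr m x.
  move=> xb xb'; exists (fun b' => if b' == b then 1 else 0) => b'.
  have [->|] := eqVneq b' b; first by rewrite xb scale1r.
  by case: b' b xb xb' => -[] //= _ -> _; rewrite scale0r.
pose S := node_gr m `&` [set x | branch false x = 0].
have hS : is_submodule S.
  apply: submoduleI; first exact: node_gr_submod.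
  apply/submoduleP; split; first by rewrite /= branch0.
  by move=> a u v /= hu hv; rewrite branchD branchZ hu hv scaler0 addr0.
apply: (chain_le _ (fun i => if i == 0%N then [set 0] else
  if i == 1%N then S else node_gr m)).
have h0 := @node_gr_submod m; split.
  move=> [|[|i]] _; split => //=; try exact: submodule_set0; try exact: sub0_submod.
  exact: subIsetl.
case=> [|[|//]] _; rewrite /=; last first.
  split; first exact: subIsetl.
  move=> h; have [x [xf xt]] := axis_ex false X0.
  have /h[_ /= e] : node_gr m x by exact: (inb false).
  by move/eqP: Xm; apply; rewrite -xf e.
split; first exact: (sub0_submod hS).
move=> h; have [x [xt xf]] := axis_ex true X0.
have /h e : S x by split=> //; exact: (inb true).
by move/eqP: Xm; apply; rewrite -xt e branch0.
Qed.

(** On each branch the Frobenius power consists of multiples of X^q, which have no term of degree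
    below q. *)
Lemma node_frobenius q m : (m < q)%N ->
  node_gr m `&` frobenius_power node_max q = [set 0].
Proof.
move=> mq; apply/seteqP; split=> [x [gx Jx]|_ ->]; last first.
  by split; [exact: (submod0 (@node_gr_submod m))|exact: (ideal0 (frobenius_power_ideal _ _))].
have [a ha] := gx.
suff dvd b : 'X^q %| branch b x.
  apply: node_eq => b; rewrite branch0 ha; have /dvdpP[h eh] := dvd b.
  have := congr1 (fun f : {poly k} => f`_m) eh.
  by rewrite coefMXn mq ha coefZ coefXn eqxx mulr1 => ->; rewrite scale0r.
move: x Jx {gx a ha}; apply: (@ideal_gen_min _ _ [set x | 'X^q %| branch b x]).
  apply/idealP; split; first by rewrite /= branch0 dvdp0.
  by move=> a u v /= hu hv; rewrite branchD branchM dvdp_addr // dvdp_mull.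
move=> _ [u hu <-] /=; rewrite branchX dvdp_exp2r //.
have := dvdp_XsubCl (branch b u) 0; rewrite subr0 => ->.
by rewrite /root branch_at0; apply/eqP.
Qed.

(* On [0, 1/q[ the function f_n is dim R_0 = 1, whereas the limit is at least
   2 on ]0, 1[. *)
Lemma node_not_uniform (RR : realType) p (hk : perfect_field p k) :
  ~ {uniform `[0, +oo[%classic,
      HK_fun RR p node_gr node_max @ \oo --> HK_density RR p node_gr node_max}.
Proof.
have setting := node_setting RR.
have pgt1 : (1 < p)%N by case: hk => /pcharf_prime/prime_gt1.
have fE n (x : RR) : 0 <= x -> x < 1 ->
    HK_fun RR p node_gr node_max n x = (len (node_gr (Num.truncn (x * (p ^ n)%:R))))%:R.
  move=> x0 x1; rewrite (HK_funE hk setting) x0 /comp_len node_frobenius ?len_set0 ?subn0 //.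
  have q0 : 0 < (p ^ n)%:R :> RR by rewrite ltr0n expn_gt0 ltnW.
  rewrite -(ltr_nat RR); apply: (@le_lt_trans _ _ (x * (p ^ n)%:R)).
    by rewrite truncn_le mulr_ge0 // ltW.
  by rewrite gtr_pMl.
have dens (x : RR) : 0 < x -> x < 1 -> 2 <= HK_density RR p node_gr node_max x.
  move=> x0 x1; have [N [l hN]] := HK_fun_eventually hk setting x.
  have -> : HK_density RR p node_gr node_max x = l.
    by apply/cvg_lim => //; apply: cvg_near_cst; exists N => // n /= /hN.
  (* Besides passing [N], this makes x q at least 1, so that f_n(x) is the dimension of a component
     of positive degree. *)
  pose n := maxn N (Num.truncn x^-1).+1.
  rewrite -(hN n (leq_maxl _ _)) fE ?(ltW x0) // (ler_nat _ 2); apply: node_gr_len.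
  rewrite truncn_ge_nat ?mulr_ge0 ?(ltW x0) // mulrC -ler_pdivrMr // div1r.
  apply: ltW; apply: lt_le_trans (truncnS_gt _) _.
  by rewrite ler_nat; apply: leq_trans (leq_maxr N _) _; exact/ltnW/ltn_expl.
move=> /(_ [set h | forall x, `[0, +oo[%classic x ->
  ball (HK_density RR p node_gr node_max x) 1 (h x)]) h.
have /h[N _ hN] : nbhs (HK_density RR p node_gr node_max : {uniform` `[0, +oo[ -> RR})
    [set h | forall x : RR, `[0, +oo[%classic x ->
  ball (HK_density RR p node_gr node_max x) 1 (h x)].
  apply/uniform_nbhs; exists [set xy | ball xy.1 1 xy.2]; split=> //.
  exact: (entourage_ball RR 1%:pos).
have q1 : 1 <= (p ^ N)%:R :> RR by rewrite ler1n expn_gt0 ltnW.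
have q0 : 0 < (p ^ N)%:R :> RR by apply: lt_le_trans q1.
(* The midpoint of [0, 1/q[ for q = p^N: here f_N(x) <= 1 while the limit is at least 2, against a
   distance less than 1. *)
pose x : RR := 2^-1 / (p ^ N)%:R.
have x0 : 0 < x by rewrite divr_gt0.
have x1 : x < 1 by rewrite ltr_pdivrMr // mul1r; apply: lt_le_trans q1; lra.
have := hN N (leqnn N) x; rewrite /= in_itv /= (ltW x0) /= => /(_ isT).
rewrite /ball /= fE ?(ltW x0) //.
have -> : Num.truncn (x * (p ^ N)%:R) = 0%N.
  by apply/eqP; rewrite truncn_eq ?mulr_ge0 ?(ltW x0) // divfK ?gt_eqF //; lra.
have [n hn n1] := flen_gr0 node_standard.
rewrite (len_flen hn); have := dens x x0 x1.
have : n%:R <= 1 :> RR by rewrite (ler_nat _ n 1).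
set d := HK_density _ _ _ _ _; move=> hn1 hd; rewrite ger0_norm; lra.
Qed.

End Node.

Theorem theorem2p19 (RR : realType) (p : nat) (k : fieldType)
    (hk : perfect_field p k) :
  (forall (R : comAlgType k) (gr : nat -> set R) (I : set R),
     HK_setting RR gr I ->
     [/\ forall x : RR, 0 <= x -> cvgn (fun n => HK_fun RR p gr I n x),
         (@lebesgue_measure RR).-integrable setT
           (fun x => (HK_density RR p gr I x)%:E),
         cvgn (HK_seq RR p I)
       & HK_multiplicity RR p I =
           (\int[@lebesgue_measure RR]_x (HK_density RR p gr I x)%:E)%E]) /\
  (exists (R : comAlgType k) (gr : nat -> set R) (I : set R),
     HK_setting RR gr I /\
     ~ {uniform `[0, +oo[%classic,
          HK_fun RR p gr I @ \oo --> HK_density RR p gr I}).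
Proof.
split=> [R gr I setting|]; first exact: HK_density_integral hk setting.
exists (node k), (@node_gr k), (@node_max k).
by split; [exact: node_setting|exact: node_not_uniform].
Qed.
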